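(* Assume the Construction below, with $(r_n)$ satisfying $\sum_{n\geq1}\frac{|\log r_n|}{2^n}<\infty$ and the sequence $(m_n)$ still free, and let $u=\lim_n u_n$ where $u_n=\frac{1}{2^n\#\mathcal S_n}\sum_{s\in\mathcal S_n}\log\max(|P_{n,s}|,\delta_n)$ (a continuous plurisubharmonic potential of the current $T=dd^cu$). Let $\psi$ be any gauge function such that $\frac{\psi(r)}{r|\log r|}\to\infty$ as $r\to0$. Then the sequence $(m_n)$ can be chosen so that $u$ is of class $C^{1+\psi}$ (locally) in $D(0,1/2)\times\mathbb{D}$.
   Context: A gauge function is a continuous increasing function $\psi$ defined on a neighborhood of $0$ in $\mathbb{R}^+$ with $\psi(0)=0$. A function is of class $C^{1+\psi}$ if it is $C^1$ and its first derivatives have modulus of continuity $O(\psi)$. Notation: $D(a,r)$ is the open disk of center $a$ and radius $r$ in $\mathbb{C}$, $\mathbb{D}=D(0,1)$, and $\mathbb{Z}^2$ is identified with the Gaussian integers $\mathbb{Z}+i\mathbb{Z}\subset\mathbb{C}$. Construction. Let $(a_n)_{n\geq1}$ be a sequence of points of $D(0,1/4)$ such that both subsequences $(a_{2p})$ and $(a_{2p+1})$ are dense in $D(0,1/4)$. Put $A_n(z,w)=z-a_n$ if $n$ is odd and $A_n(z,w)=z+\frac{w}{100}-a_n$ if $n$ is even. Let $(r_n)_{n\geq1}$ be a sequence of positive reals decreasing to $0$ with $r_n\leq 1/10$, and $(m_n)_{n\geq1}$ a sequence of positive integers. Define $\delta_0=1/2$, $\delta_{n+1}=\frac{\delta_n^2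 r_{n+1}}{4m_{n+1}^2}$ and $\varepsilon_{n+1}=\frac{\delta_n^2}{2m_{n+1}^2}$. Put $\Sigma_{n+1}=\overline{D}\big(0,\delta_n(1-\frac1{m_{n+1}})\big)\cap\frac{3\delta_n}{m_{n+1}}\mathbb{Z}^2$ (a finite set). Let $\mathcal S_0=\{0\}$, $P_{0,0}(z,w)=w$, and inductively $\mathcal S_{n+1}=\mathcal S_n\times\Sigma_{n+1}$ and, for $s'=(s,\sigma)\in\mathcal S_{n+1}$, $P_{n+1,s'}=(P_{n,s}-\sigma)^2-\varepsilon_{n+1}A_{n+1}$. Set (all sets taken in $D(0,1/2)\times\mathbb{D}$) $X_{n,s}=\{|P_{n,s}|<\delta_n\}$, $X_n=\bigcup_{s\in\mathcal S_n}X_{n,s}$, and $X^{\mathrm{int}}_{n+1,s,\sigma}=\{|P_{n,s}-\sigma|<\delta_n/m_{n+1}\}$ for $s\in\mathcal S_n,\sigma\in\Sigma_{n+1}$. *)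

(* Defs.v *)
From Stdlib Require Import Reals Lra ZArith List.
Import ListNotations.
Open Scope R_scope.

Definition Cx := (R * R)%type.
Definition Cadd (a b : Cx) : Cx := (fst a + fst b, snd a + snd b).
Definition Csub (a b : Cx) : Cx := (fst a - fst b, snd a - snd b).
Definition Cmul (a b : Cx) : Cx :=
  (fst a * fst b - snd a * snd b, fst a * snd b + snd a * fst b).
Definition Cscale (t : R) (a : Cx) : Cx := (t * fst a, t * snd a).
Definition Cmod (a : Cx) : R := sqrt (fst a ^ 2 + snd a ^ 2).

Definition pt := (Cx * Cx)%type.
Definition padd (p q : pt) : pt := (Cadd (fst p) (fst q), Cadd (snd p) (snd q)).
Definition pnorm (p : pt) : R := sqrt (Cmod (fst p) ^ 2 + Cmod (snd p) ^ 2).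
Definition pdist (p q : pt) : R :=
  pnorm (Csub (fst p) (fst q), Csub (snd p) (snd q)).
Definition pdot (p q : pt) : R :=
  fst (fst p) * fst (fst q) + snd (fst p) * snd (fst q)
  + fst (snd p) * fst (snd q) + snd (snd p) * snd (snd q).

Definition Omega (p : pt) : Prop := Cmod (fst p) < 1/2 /\ Cmod (snd p) < 1.

(* a, r, m are indexed from 1; the value at index 0 is irrelevant. *)
Fixpoint delta (r : nat -> R) (m : nat -> nat) (n : nat) : R :=
  match n with
  | O => 1/2
  | S k => (delta r m k) ^ 2 * r (S k) / (4 * (INR (m (S k))) ^ 2)
  end.

Definition eps (r : nat -> R) (m : nat -> nat) (n : nat) : R :=
  match n with
  | O => 0
  | S k => (delta r m k) ^ 2 / (2 * (INR (m (S k))) ^ 2)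
  end.

Definition Afun (a : nat -> Cx) (n : nat) (p : pt) : Cx :=
  if Nat.odd n then Csub (fst p) (a n)
  else Csub (Cadd (fst p) (Cscale (1/100) (snd p))) (a n).

(* Sigma_{n+1} = closed disk(0, delta_n (1 - 1/m_{n+1})) inter (3 delta_n/m_{n+1}) Z^2,
   listed without repetition (all such lattice points have |i|,|j| <= m). *)
Definition Zrange (m : nat) : list Z :=
  map (fun k => (Z.of_nat k - Z.of_nat m)%Z) (seq 0 (2 * m + 1)).

Definition Sigma (r : nat -> R) (m : nat -> nat) (n : nat) : list Cx :=
  let d := delta r m n in
  let M := m (S n) in
  let h := 3 * d / INR M in
  filter (fun s => if Rle_dec (Cmod s) (d * (1 - 1 / INR M)) then true else false)
    (flat_map (fun i => map (fun j => (h * IZR i, h * IZR j)) (Zrange M)) (Zrange M)).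

Fixpoint Slist (r : nat -> R) (m : nat -> nat) (n : nat) : list (list Cx) :=
  match n with
  | O => [ [] ]
  | S k => flat_map (fun s => map (fun sg => s ++ [sg]) (Sigma r m k)) (Slist r m k)
  end.

Fixpoint Paux (a : nat -> Cx) (r : nat -> R) (m : nat -> nat) (p : pt)
    (k : nat) (v : Cx) (s : list Cx) : Cx :=
  match s with
  | [] => v
  | sg :: s' =>
      Paux a r m p (S k)
        (Csub (Cmul (Csub v sg) (Csub v sg))
              (Cscale (eps r m (S k)) (Afun a (S k) p))) s'
  end.

Definition Pfun (a : nat -> Cx) (r : nat -> R) (m : nat -> nat) (s : list Cx) (p : pt) : Cx :=
  Paux a r m p 0 (snd p) s.

Definition u_n (a : nat -> Cx) (r : nat -> R) (m : nat -> nat) (n : nat) (p : pt) : R :=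
  / (2 ^ n * INR (length (Slist r m n))) *
  fold_right Rplus 0
    (map (fun s => ln (Rmax (Cmod (Pfun a r m s p)) (delta r m n))) (Slist r m n)).

Definition gauge (psi : R -> R) : Prop :=
  exists rho, 0 < rho /\ psi 0 = 0 /\
    (forall x y, 0 <= x -> x <= y -> y < rho -> psi x <= psi y) /\
    (forall x, 0 <= x < rho -> forall e, 0 < e -> exists d, 0 < d /\
       forall y, 0 <= y < rho -> Rabs (y - x) < d -> Rabs (psi y - psi x) < e).

Definition locally_C1psi (psi : R -> R) (U : pt -> Prop) (u : pt -> R) : Prop :=
  exists g : pt -> pt,
    (forall p, U p -> forall e, 0 < e -> exists d, 0 < d /\
        forall h, pnorm h < d ->
          Rabs (u (padd p h) - u p - pdot (g p) h) <= e * pnorm h) /\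
    (forall p, U p -> exists rho K, 0 < rho /\
        (forall q, pdist q p < rho -> U q) /\
        forall x y, pdist x p < rho -> pdist y p < rho ->
          pdist (g x) (g y) <= K * psi (pdist x y)).

(* Main.v *)
From Stdlib Require Import Reals Lra Lia Psatz ZArith List IndefiniteDescription.
Require Import Defs.
From Coquelicot Require Import Coquelicot.
Import ListNotations.
Open Scope R_scope.

(** Replace [u_n] by the smooth potentials [V_n], the averages over [s] in [S_n] and
    [sigma] in [Sigma_(n+1)] of [2^-n * log (|P_s - sigma|^2 + k^2) / 2] with
    [k = delta_n / m_(n+1)], and let [W_n] be their complex gradient.  Averages of
    [|z - sigma|^-j] over the lattice are controlled by counting points in shells, which
    gives three facts with constants depending only on [n], [delta_n] and [r_(n+1)]:
    - [|W_(n+1) - W_n| <= C / m_(n+1)], as [P_(n+1) = (P_n - sigma)^2 - eps A] is close to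
      [(P_n - sigma)^2] except for the few [sigma] near [P_n], each of weight [O(m^-2)];
    - [W_(n+1)] has modulus of continuity [C t |log t|] at scales [t <= c / m_(n+1)];
    - both bounds are uniform in [m_(n+2)], because the average over [Sigma_(n+2)] of the
      Cauchy kernel is log-Lipschitz uniformly in the mesh.
    At scales above [c / m_(n+1)] the modulus of [W_(n+1)] is that of [W_n] up to
    [C / m_(n+1)]; since [psi] dominates [t |log t|], taking [m_(n+1)] large keeps all the
    [W_n] uniformly [O(psi)]-continuous, and the limit inherits this. *)

(** Write [Z = P_s - sigma], [q] for a partial derivative of [P_s], and [P' = Z^2 - eps A] for the
    child polynomial. With [c] the derivative of [A], half the logarithmic derivative of [P'] is
    [(2 Z q - eps c) / (2 P')], which is [q / Z] up to an error of order [eps / |Z|^3]: the weight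
    1/2 lost from one level to the next offsets the squaring. This is why level n+1 is compared with
    a kernel average attached to level n. The obstacle is that the constants at level n+1 blow up
    with [1 / delta_n] and [1 / r_(n+1)]. The modulus constant is used only at scales of order at
    most [delta_n / m_(n+1)], where [psi t / (t |log t|)] exceeds any number fixed before [m_(n+1)].
    The summability of [|log r_n| / 2^n] enters when [u_(n+1)] is compared with [V_n]: near the
    zeros of [P'] only the truncation at [delta_(n+1)], proportional to [r_(n+1)], bounds the
    logarithm from below. *)

(** * Finite sums and averages *)

Definition rsum {T : Type} (f : T -> R) (l : list T) : R :=
  fold_right Rplus 0 (map f l).

Definition avg {T : Type} (f : T -> R) (l : list T) : R :=
  / INR (length l) * rsum f l.

Lemma rsum_cons {T} (f : T -> R) x l : rsum f (x :: l) = f x + rsum f l.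
Proof. reflexivity. Qed.

Lemma rsum_app {T} (f : T -> R) l1 l2 : rsum f (l1 ++ l2) = rsum f l1 + rsum f l2.
Proof.
  induction l1 as [|x l1 IH]; simpl; [unfold rsum at 2; simpl; ring|].
  rewrite !rsum_cons, IH; ring.
Qed.

Lemma rsum_map {T U} (f : U -> R) (g : T -> U) l :
  rsum f (map g l) = rsum (fun x => f (g x)) l.
Proof. unfold rsum; now rewrite map_map. Qed.

Lemma rsum_flat_map {T U} (f : U -> R) (g : T -> list U) l :
  rsum f (flat_map g l) = rsum (fun x => rsum f (g x)) l.
Proof.
  induction l as [|x l IH]; [reflexivity|].
  simpl; now rewrite rsum_app, rsum_cons, IH.
Qed.

Lemma rsum_le {T} (f g : T -> R) l :
  (forall x, In x l -> f x <= g x) -> rsum f l <= rsum g l.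
Proof.
  induction l as [|x l IH]; intros H; [unfold rsum; simpl; lra|].
  rewrite !rsum_cons.
  apply Rplus_le_compat; [apply H; now left | apply IH; intros; apply H; now right].
Qed.

Lemma rsum_ext {T} (f g : T -> R) l :
  (forall x, In x l -> f x = g x) -> rsum f l = rsum g l.
Proof.
  intros H; apply Rle_antisym; apply rsum_le; intros x Hx; rewrite (H x Hx); lra.
Qed.

Lemma rsum_plus {T} (f g : T -> R) l :
  rsum (fun x => f x + g x) l = rsum f l + rsum g l.
Proof.
  induction l as [|x l IH]; [unfold rsum; simpl; ring|].
  rewrite !rsum_cons, IH; ring.
Qed.

Lemma rsum_scal {T} (c : R) (f : T -> R) l :
  rsum (fun x => c * f x) l = c * rsum f l.
Proof.
  induction l as [|x l IH]; [unfold rsum; simpl; ring|].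
  rewrite !rsum_cons, IH; ring.
Qed.

Lemma rsum_const {T} (c : R) (l : list T) : rsum (fun _ => c) l = INR (length l) * c.
Proof.
  induction l as [|x l IH]; [unfold rsum; simpl; ring|].
  rewrite rsum_cons, IH; change (length (x :: l)) with (S (length l)); rewrite S_INR; ring.
Qed.

Lemma rsum_filter_le {T} (b : T -> bool) (f : T -> R) l :
  (forall x, 0 <= f x) -> rsum f (filter b l) <= rsum f l.
Proof.
  intros H; induction l as [|x l IH]; [unfold rsum; simpl; lra|].
  simpl; destruct (b x); rewrite ?rsum_cons; specialize (H x); lra.
Qed.

Lemma inv_length_ge0 {T} (l : list T) : 0 <= / INR (length l).
Proof.
  destruct l as [|x l]; [simpl; rewrite Rinv_0; lra|].
  left; apply Rinv_0_lt_compat, lt_0_INR; simpl; lia.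
Qed.

Lemma avg_le {T} (f g : T -> R) l :
  (forall x, In x l -> f x <= g x) -> avg f l <= avg g l.
Proof.
  intros H; apply Rmult_le_compat_l; [apply inv_length_ge0 | now apply rsum_le].
Qed.

Lemma avg_ext {T} (f g : T -> R) l :
  (forall x, In x l -> f x = g x) -> avg f l = avg g l.
Proof. intros H; unfold avg; now rewrite (rsum_ext f g). Qed.

Lemma avg_plus {T} (f g : T -> R) l :
  avg (fun x => f x + g x) l = avg f l + avg g l.
Proof. unfold avg; rewrite rsum_plus; ring. Qed.

Lemma avg_scal {T} (c : R) (f : T -> R) l :
  avg (fun x => c * f x) l = c * avg f l.
Proof. unfold avg; rewrite rsum_scal; ring. Qed.

Lemma avg_minus {T} (f g : T -> R) l :
  avg (fun x => f x - g x) l = avg f l - avg g l.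
Proof.
  rewrite (avg_ext _ (fun x => f x + (-1) * g x)) by (intros; ring).
  rewrite avg_plus, avg_scal; ring.
Qed.

Lemma avg_const {T} (c : R) (l : list T) : l <> [] -> avg (fun _ => c) l = c.
Proof.
  intros H; unfold avg; rewrite rsum_const; field.
  apply not_0_INR; destruct l; [congruence | simpl; lia].
Qed.

Lemma Rabs_avg_le {T} (f b : T -> R) l :
  (forall x, In x l -> Rabs (f x) <= b x) -> Rabs (avg f l) <= avg b l.
Proof.
  intros H; apply Rabs_le; split.
  - rewrite <- (Ropp_involutive (avg f l)); apply Ropp_le_contravar.
    replace (- avg f l) with (avg (fun x => -1 * f x) l) by (rewrite avg_scal; ring).
    apply avg_le; intros x Hx; specialize (H x Hx); apply Rabs_le_between in H; lra.
  - apply avg_le; intros x Hx; specialize (H x Hx); apply Rabs_le_between in H; lra.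
Qed.

Lemma length_flat_map_map {T U V} (g : T -> U -> V) (l1 : list T) (l2 : list U) :
  length (flat_map (fun s => map (g s) l2) l1) = (length l1 * length l2)%nat.
Proof.
  induction l1 as [|x l1 IH]; [reflexivity|].
  simpl; rewrite length_app, length_map, IH; lia.
Qed.

(** Every node has the same number of children, so an average over level n+1 of the tree is an
    average over level n of averages over [Sigma]. *)
Lemma avg_flat_map {T U V} (f : V -> R) (g : T -> U -> V) (l1 : list T) (l2 : list U) :
  avg f (flat_map (fun s => map (g s) l2) l1)
  = avg (fun s => avg (fun x => f (g s x)) l2) l1.
Proof.
  unfold avg at 1 2; rewrite length_flat_map_map, mult_INR, Rinv_mult, rsum_flat_map.
  unfold avg; rewrite rsum_scal.
  rewrite (rsum_ext (fun x => rsum f (map (g x) l2))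
             (fun x => rsum (fun y => f (g x y)) l2)) by (intros; apply rsum_map).
  ring.
Qed.

Definition avgC {T : Type} (f : T -> C) (l : list T) : C :=
  (avg (fun x => fst (f x)) l, avg (fun x => snd (f x)) l).

Lemma avgC_ext {T} (f g : T -> C) l :
  (forall x, In x l -> f x = g x) -> avgC f l = avgC g l.
Proof.
  intros H; unfold avgC; f_equal; apply avg_ext; intros x Hx; now rewrite H.
Qed.

Lemma avgC_minus {T} (f g : T -> C) l :
  avgC (fun x => f x - g x)%C l = (avgC f l - avgC g l)%C.
Proof.
  unfold avgC, Cminus, Cplus, Copp; simpl; f_equal; apply avg_minus.
Qed.

Lemma avgC_mult {T} (c : C) (f : T -> C) l :
  avgC (fun x => c * f x)%C l = (c * avgC f l)%C.
Proof.
  unfold avgC, Cmult; simpl; f_equal.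
  - now rewrite avg_minus, !avg_scal.
  - now rewrite avg_plus, !avg_scal.
Qed.

Lemma avgC_const {T} (c : C) (l : list T) : l <> [] -> avgC (fun _ => c) l = c.
Proof. intros H; destruct c; unfold avgC; simpl; now rewrite !avg_const. Qed.

Lemma avgC_flat_map {T U V} (f : V -> C) (g : T -> U -> V) (l1 : list T) (l2 : list U) :
  avgC f (flat_map (fun s => map (g s) l2) l1)
  = avgC (fun s => avgC (fun x => f (g s x)) l2) l1.
Proof.
  unfold avgC at 1.
  rewrite (avg_flat_map (fun v => fst (f v))), (avg_flat_map (fun v => snd (f v))).
  reflexivity.
Qed.

Lemma Cmod_rsum_le {T} (f : T -> C) l :
  Cmod (rsum (fun x => fst (f x)) l, rsum (fun x => snd (f x)) l)
  <= rsum (fun x => Cmod (f x)) l.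
Proof.
  induction l as [|x l IH].
  - unfold rsum; simpl; change (0, 0) with (RtoC 0); rewrite Cmod_0; lra.
  - rewrite !rsum_cons.
    change (fst (f x) + rsum (fun x => fst (f x)) l,
            snd (f x) + rsum (fun x => snd (f x)) l)
      with (Cplus (f x) (rsum (fun x => fst (f x)) l, rsum (fun x => snd (f x)) l)).
    eapply Rle_trans; [apply Cmod_triangle|]; lra.
Qed.

Lemma Cmod_avgC_le {T} (f : T -> C) (b : T -> R) l :
  (forall x, In x l -> Cmod (f x) <= b x) -> Cmod (avgC f l) <= avg b l.
Proof.
  intros H; unfold avgC, avg.
  replace (/ INR (length l) * rsum (fun x => fst (f x)) l,
           / INR (length l) * rsum (fun x => snd (f x)) l)
    with (RtoC (/ INR (length l))
          * (rsum (fun x => fst (f x)) l, rsum (fun x => snd (f x)) l))%C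
    by (unfold Cmult, RtoC; simpl; f_equal; ring).
  rewrite Cmod_mult, Cmod_R, Rabs_pos_eq by apply inv_length_ge0.
  apply Rmult_le_compat_l; [apply inv_length_ge0|].
  eapply Rle_trans; [apply Cmod_rsum_le | now apply rsum_le].
Qed.

Lemma Cmod_avgC_minus_le {T} (f g : T -> C) (b : T -> R) l :
  (forall x, In x l -> Cmod (f x - g x) <= b x) ->
  Cmod (avgC f l - avgC g l) <= avg b l.
Proof. intros H; rewrite <- avgC_minus; now apply Cmod_avgC_le. Qed.

(** * Lattice sums *)

Definition antitone (f : R -> R) : Prop := forall x y, 0 <= x -> x <= y -> f y <= f x.

(* Of n+1 consecutive integers, one of the two extreme ones is at distance at least n/2 from a. *)
Lemma rsum_dist_le f a s n : antitone f ->
  rsum (fun k => f (Rabs (INR k - a))) (seq s n)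
  <= rsum (fun q => f (INR q / 2)) (seq 0 n).
Proof.
  intros f_anti; revert s; induction n as [|n IH]; intros s; [unfold rsum; simpl; lra|].
  rewrite (seq_S n 0), rsum_app.
  unfold rsum at 3; simpl fold_right; rewrite Rplus_0_r.
  pose proof (pos_INR n) as Hn.
  destruct (Rle_dec a (INR s + INR n / 2)) as [Ha|Ha].
  - rewrite seq_S, rsum_app; unfold rsum at 2; simpl fold_right; rewrite Rplus_0_r.
    apply Rplus_le_compat; [apply IH|]; simpl; apply f_anti; [lra|].
    rewrite plus_INR; rewrite Rabs_pos_eq; lra.
  - change (seq s (S n)) with (s :: seq (S s) n); rewrite rsum_cons, Rplus_comm.
    apply Rplus_le_compat; [apply IH|]; simpl; apply f_anti; [lra|].
    rewrite Rabs_left1; lra.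
Qed.

Lemma rsum_Zrange_le f a M : antitone f ->
  rsum (fun i => f (Rabs (IZR i - a))) (Zrange M)
  <= rsum (fun q => f (INR q / 2)) (seq 0 (2 * M + 1)).
Proof.
  intros f_anti; unfold Zrange; rewrite rsum_map.
  rewrite (rsum_ext _ (fun k => f (Rabs (INR k - (INR M + a))))).
  - now apply rsum_dist_le.
  - intros k _; f_equal; f_equal.
    rewrite minus_IZR, <- !INR_IZR_INZ; ring.
Qed.

Lemma rsum_seq_S (g : nat -> R) L : rsum g (seq 0 (S L)) = rsum g (seq 0 L) + g L.
Proof. rewrite seq_S, rsum_app; unfold rsum at 2; simpl; ring. Qed.

(** The pairs with [max k l = q] number [2 q + 1] and have [(k + l) / 2 >= q / 2]; the induction
    adds one such shell at a time. *)
Lemma rsum_shells_le f L : antitone f ->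
  rsum (fun k => rsum (fun l => f (INR k / 2 + INR l / 2)) (seq 0 L)) (seq 0 L)
  <= rsum (fun q => (2 * INR q + 1) * f (INR q / 2)) (seq 0 L).
Proof.
  intros f_anti; induction L as [|L IH]; [unfold rsum; simpl; lra|].
  rewrite (rsum_seq_S (fun q => (2 * INR q + 1) * f (INR q / 2))), (rsum_seq_S (fun k => rsum _ _)).
  rewrite (rsum_ext _ (fun k => rsum (fun l => f (INR k / 2 + INR l / 2)) (seq 0 L)
             + f (INR k / 2 + INR L / 2))) by (intros; apply (rsum_seq_S (fun l => f (INR x / 2 + INR l / 2)))).
  rewrite rsum_plus, (rsum_seq_S (fun l => f (INR L / 2 + INR l / 2))).
  pose proof (pos_INR L) as HL.
  assert (H1 : rsum (fun k => f (INR k / 2 + INR L / 2)) (seq 0 L) <= INR L * f (INR L / 2)).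
  { eapply Rle_trans; [apply rsum_le with (g := fun _ => f (INR L / 2))
                        | rewrite rsum_const, length_seq; lra].
    intros k _; pose proof (pos_INR k); apply f_anti; lra. }
  assert (H2 : rsum (fun l => f (INR L / 2 + INR l / 2)) (seq 0 L) <= INR L * f (INR L / 2)).
  { eapply Rle_trans; [apply rsum_le with (g := fun _ => f (INR L / 2))
                        | rewrite rsum_const, length_seq; lra].
    intros k _; pose proof (pos_INR k); apply f_anti; lra. }
  assert (H3 : f (INR L / 2 + INR L / 2) <= f (INR L / 2)) by (apply f_anti; lra).
  lra.
Qed.

Lemma rsum_Zrange2_le (f : R -> R) a b M : antitone f ->
  rsum (fun i => rsum (fun j => f (Rabs (IZR i - a) + Rabs (IZR j - b))) (Zrange M)) (Zrange M)
  <= rsum (fun q => (2 * INR q + 1) * f (INR q / 2)) (seq 0 (2 * M + 1)).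
Proof.
  intros Ha.
  eapply Rle_trans; [|apply (rsum_shells_le f _ Ha)].
  eapply Rle_trans;
    [| apply (rsum_Zrange_le (fun x => rsum (fun l => f (x + INR l / 2)) (seq 0 (2 * M + 1))))].
  - apply rsum_le; intros i _.
    apply (rsum_Zrange_le (fun x => f (Rabs (IZR i - a) + x))).
    intros x y Hx Hy; pose proof (Rabs_pos (IZR i - a)); apply Ha; lra.
  - intros x y Hx Hy; apply rsum_le; intros l _; pose proof (pos_INR l); apply Ha; lra.
Qed.

(** [Sigma] with radius and mesh parameter as free arguments, so that the parameter need not be
    [m (S n)]. The copy is literal, so [Sigma_lat] holds by computation. *)
Definition lat (d : R) (M : nat) : list C :=
  let h := 3 * d / INR M in
  filter (fun s => if Rle_dec (Cmod s) (d * (1 - 1 / INR M)) then true else false)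
    (flat_map (fun i => map (fun j => (h * IZR i, h * IZR j)) (Zrange M)) (Zrange M)).

Lemma Sigma_lat r m n : Sigma r m n = lat (delta r m n) (m (S n)).
Proof. reflexivity. Qed.

Lemma lat_Cmod d M s : 0 < d -> (1 <= M)%nat -> In s (lat d M) -> Cmod s <= d.
Proof.
  intros Hd HM H; apply filter_In in H; destruct H as [_ H].
  destruct (Rle_dec _ _) as [H'|]; [|discriminate].
  eapply Rle_trans; [apply H'|].
  assert (0 < / INR M) by (apply Rinv_0_lt_compat, lt_0_INR; lia).
  unfold Rdiv; nra.
Qed.

Lemma length_filter_app {T} (p : T -> bool) l1 l2 :
  length (filter p (l1 ++ l2)) = (length (filter p l1) + length (filter p l2))%nat.
Proof. now rewrite filter_app, length_app. Qed.

Lemma length_filter_flat_map_ge {T U} (p : U -> bool) (g : T -> list U) l n :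
  (forall x, In x l -> (n <= length (filter p (g x)))%nat) ->
  (length l * n <= length (filter p (flat_map g l)))%nat.
Proof.
  induction l as [|x l IH]; intros H; [simpl; lia|].
  simpl; rewrite length_filter_app.
  specialize (H x (or_introl eq_refl)) as Hx.
  assert (length l * n <= length (filter p (flat_map g l)))%nat
    by (apply IH; intros; apply H; now right).
  lia.
Qed.

Lemma Zrange_block M K : (K <= M)%nat ->
  exists l1 l2 l3, Zrange M = l1 ++ l2 ++ l3 /\ length l2 = (2 * K + 1)%nat /\
    forall i, In i l2 -> (Z.abs i <= Z.of_nat K)%Z.
Proof.
  intros H; unfold Zrange.
  replace (2 * M + 1)%nat with ((M - K) + ((2 * K + 1) + (M - K)))%nat by lia.
  rewrite (seq_app (M - K)), seq_app, !map_app.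
  eexists _, _, _; split; [reflexivity|split].
  - now rewrite length_map, length_seq.
  - intros i Hi; apply in_map_iff in Hi; destruct Hi as [k [<- Hk]].
    apply in_seq in Hk; lia.
Qed.

(* The central block |i|, |j| <= K lies in the disk as soon as 6 K <= M - 1. *)
Lemma length_lat_ge d M : 0 < d -> (1 <= M)%nat ->
  (INR M) ^ 2 / 36 <= INR (length (lat d M)).
Proof.
  intros Hd HM.
  set (K := ((M - 1) / 6)%nat).
  assert (HK : (6 * K <= M - 1 /\ M <= 6 * (2 * K + 1))%nat).
  { pose proof (Nat.div_mod (M - 1) 6 ltac:(lia)); pose proof (Nat.mod_upper_bound (M - 1) 6 ltac:(lia)).
    fold K in H; lia. }
  destruct (Zrange_block M K ltac:(lia)) as (l1 & l2 & l3 & E & L & B).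
  assert (HMp : 0 < INR M) by (apply lt_0_INR; lia).
  assert (Hlen : ((2 * K + 1) * (2 * K + 1) <= length (lat d M))%nat).
  { unfold lat; rewrite E, !flat_map_app, !length_filter_app.
    set (p := fun s : C => _); set (g := fun i : Z => _).
    assert (H : ((2 * K + 1) * (2 * K + 1) <= length (filter p (flat_map g l2)))%nat).
    { rewrite <- L at 1; apply length_filter_flat_map_ge.
      intros i Hi; unfold g; rewrite !map_app, !length_filter_app.
      assert (forall l, incl l l2 ->
        length (filter p (map (fun j => (3 * d / INR M * IZR i, 3 * d / INR M * IZR j)) l)) = length l) as Hall.
      { induction l as [|j l IH]; intros Hl; [reflexivity|].
        cbn [map filter].
        replace (p _) with true.
        - simpl; f_equal; apply IH; intros x Hx; apply Hl; now right.
        - unfold p; destruct (Rle_dec _ _) as [|Hn]; [reflexivity|exfalso; apply Hn].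
          assert (Hj := B j (Hl j (or_introl eq_refl))); specialize (B i Hi).
          apply IZR_le in Hj; apply IZR_le in B; rewrite abs_IZR, <- INR_IZR_INZ in Hj, B.
          assert (H6 : 6 * INR K <= INR M - 1).
          { destruct HK as [HK _]; apply le_INR in HK.
            rewrite mult_INR, minus_INR in HK by lia; simpl in HK; lra. }
          apply Rsqr_incr_0_var.
          + unfold Rsqr, Complex.Cmod.
            rewrite sqrt_sqrt by (simpl; nra); simpl fst; simpl snd.
            assert (Hi2 : IZR i ^ 2 <= INR K ^ 2)
              by (rewrite <- (pow2_abs (IZR i)); apply pow_incr; split; [apply Rabs_pos|exact B]).
            assert (Hj2 : IZR j ^ 2 <= INR K ^ 2)
              by (rewrite <- (pow2_abs (IZR j)); apply pow_incr; split; [apply Rabs_pos|exact Hj]).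
            replace (d * (1 - 1 / INR M) * (d * (1 - 1 / INR M)))
              with ((d / INR M) ^ 2 * (INR M - 1) ^ 2) by (field; lra).
            replace ((3 * d / INR M * IZR i) ^ 2 + (3 * d / INR M * IZR j) ^ 2)
              with ((d / INR M) ^ 2 * (9 * (IZR i ^ 2 + IZR j ^ 2))) by (field; lra).
            apply Rmult_le_compat_l; [nra|].
            pose proof (pos_INR K); nra.
          + assert (1 <= INR M) by (apply (le_INR 1); lia).
            apply Rmult_le_pos; [lra|].
            replace (1 - 1 / INR M) with ((INR M - 1) / INR M) by (field; lra).
            apply Rdiv_le_0_compat; lra. }
      specialize (Hall l2 (incl_refl l2)); lia. }
    lia. }
  apply le_INR in Hlen; rewrite mult_INR in Hlen.
  destruct HK as [_ HK]; apply le_INR in HK; rewrite mult_INR in HK.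
  replace (INR 6) with 6 in HK by (simpl; ring).
  pose proof (pos_INR (2 * K + 1)).
  eapply Rle_trans; [|exact Hlen].
  set (X := INR (2 * K + 1)) in *.
  assert (0 <= (6 * X - INR M) * (6 * X + INR M)) by (apply Rmult_le_pos; lra).
  replace (INR M ^ 2) with (INR M * INR M) by ring; nra.
Qed.

Lemma lat_neq_nil d M : 0 < d -> (1 <= M)%nat -> lat d M <> [].
Proof.
  intros Hd HM E; pose proof (length_lat_ge d M Hd HM) as H; rewrite E in H; simpl length in H.
  assert (0 < INR M) by (apply lt_0_INR; lia).
  change (INR 0) with 0 in H; nra.
Qed.

(** The mesh is [3 k]; if [(a, b)] is [z] in mesh units, then [|z - s| >= 3 k max(|i - a|, |j - b|)
    >= k (|i - a| + |j - b|)]. As [phi] is decreasing and nonnegative, the sum may be extended from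
    the disk to the square and counted by shells; [36 / M^2] bounds the inverse number of points. *)
Lemma avg_lat_le d M (z : C) (phi : R -> R) :
  0 < d -> (1 <= M)%nat ->
  (forall x y, 0 < x -> x <= y -> phi y <= phi x) ->
  (forall x, 0 < x -> 0 <= phi x) ->
  let k := d / INR M in
  avg (fun s => phi (Cmod (z - s)%C + k)) (lat d M)
  <= 36 / (INR M) ^ 2 *
     rsum (fun q => (2 * INR q + 1) * phi (k * (INR q / 2 + 1))) (seq 0 (2 * M + 1)).
Proof.
  intros Hd HM Ha Hp k.
  assert (HMp : 0 < INR M) by (apply lt_0_INR; lia).
  assert (Hk : 0 < k) by (apply Rdiv_lt_0_compat; lra).
  unfold avg; apply Rmult_le_compat.
  - apply inv_length_ge0.
  - rewrite <- (Rmult_0_r (INR (length (lat d M)))), <- rsum_const.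
    apply rsum_le; intros s _; apply Hp; pose proof (Cmod_ge_0 (z - s)%C); lra.
  - replace (36 / INR M ^ 2) with (/ (INR M ^ 2 / 36)) by (field; lra).
    apply Rinv_le_contravar; [|now apply length_lat_ge].
    assert (0 < INR M ^ 2) by (apply pow_lt; lra); lra.
  - unfold lat; eapply Rle_trans; [apply rsum_filter_le|].
    { intros s; apply Hp; pose proof (Cmod_ge_0 (z - s)%C); lra. }
    rewrite rsum_flat_map.
    eapply Rle_trans; [|apply (rsum_Zrange2_le (fun x => phi (k * (x + 1))) (fst z / (3 * k)) (snd z / (3 * k)))].
    + apply rsum_le; intros i _; rewrite rsum_map; apply rsum_le; intros j _.
      pose proof (Rabs_pos (IZR i - fst z / (3 * k))) as P1.
      pose proof (Rabs_pos (IZR j - snd z / (3 * k))) as P2.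
      apply Ha; [apply Rmult_lt_0_compat; lra|].
      pose proof (Rmax_Cmod (Cminus z ((3 * d / INR M * IZR i)%R, (3 * d / INR M * IZR j)%R))) as HC.
      simpl in HC.
      assert (E : forall x (n : Z), Rabs (x + - (3 * d / INR M * IZR n)) = 3 * k * Rabs (IZR n - x / (3 * k))).
      { intros x n; rewrite <- (Rabs_pos_eq (3 * k)) at 1 by lra.
        rewrite <- Rabs_mult, <- Rabs_Ropp; f_equal; unfold k; field; lra. }
      rewrite !E in HC.
      pose proof (Rmax_l (3 * k * Rabs (IZR i - fst z / (3 * k))) (3 * k * Rabs (IZR j - snd z / (3 * k)))).
      pose proof (Rmax_r (3 * k * Rabs (IZR i - fst z / (3 * k))) (3 * k * Rabs (IZR j - snd z / (3 * k)))).
      match goal with |- _ <= Cmod ?w + _ => set (W := Cmod w) in * end; nra.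
    + intros x y Hx Hy; apply Ha; nra.
Qed.

Lemma ln_le_sub1 x : 0 < x -> ln x <= x - 1.
Proof.
  intros Hx; pose proof (exp_ineq1_le (ln x)) as H; rewrite exp_ln in H; lra.
Qed.

(** Comparison with the integral of [1 / x], in telescoping form: [ln y <= y - 1] at
    [y = (X + L) / (X + L + 1)] bounds the new term by the increment of the logarithm. *)
Lemma rsum_inv_le X L : 0 < X ->
  rsum (fun q => / (INR q + 1 + X)) (seq 0 L) <= ln (1 + INR L / X).
Proof.
  intros HX; induction L as [|L IH].
  - unfold rsum; simpl; replace (1 + 0 / X) with 1 by (field; lra); rewrite ln_1; lra.
  - rewrite rsum_seq_S, S_INR; pose proof (pos_INR L).
    assert (H1 : 0 < (X + INR L) / (X + INR L + 1)) by (apply Rdiv_lt_0_compat; lra).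
    pose proof (ln_le_sub1 _ H1) as Hln.
    replace (1 + (INR L + 1) / X)
      with ((1 + INR L / X) * / ((X + INR L) / (X + INR L + 1))) by (field; lra).
    rewrite ln_mult, ln_Rinv; [| exact H1 | | now apply Rinv_0_lt_compat].
    + replace (/ (INR L + 1 + X)) with (1 - (X + INR L) / (X + INR L + 1)) by (field; lra).
      lra.
    + assert (0 <= INR L / X) by (apply Rdiv_le_0_compat; lra); lra.
Qed.

Lemma rsum_inv_sqr_le L : rsum (fun q => / (INR q + 2) ^ 2) (seq 0 L) <= 1 - / (INR L + 1).
Proof.
  induction L as [|L IH].
  - unfold rsum; simpl; rewrite Rplus_0_l, Rinv_1; lra.
  - rewrite rsum_seq_S, S_INR; pose proof (pos_INR L).
    assert (/ (INR L + 2) ^ 2 <= / (INR L + 1) - / (INR L + 1 + 1)); [|lra].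
    replace (/ (INR L + 1) - / (INR L + 1 + 1)) with (/ ((INR L + 1) * (INR L + 2))) by (field; lra).
    apply Rinv_le_contravar; nra.
Qed.

Lemma le_Rdiv a b c : 0 < b -> a <= c * b -> a / b <= c.
Proof.
  intros Hb H; apply Rmult_le_reg_r with b; [lra|].
  unfold Rdiv; rewrite Rmult_assoc, Rinv_l; lra.
Qed.

Lemma INR_2M1 M : (1 <= M)%nat -> INR (2 * M + 1) <= 3 * INR M.
Proof.
  intros H; apply (le_INR 1) in H.
  rewrite plus_INR, mult_INR; simpl in *; lra.
Qed.

(** [1 / |z|] is locally integrable in the plane: each of the at most [3 M] shells contributes at
    most [4 / k] with [k = d / M], and 432 is [36 * 3 * 4]. *)
Lemma avg_lat_inv d M z : 0 < d -> (1 <= M)%nat ->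
  avg (fun s => / (Cmod (z - s)%C + d / INR M)) (lat d M) <= 432 / d.
Proof.
  intros Hd HM.
  assert (HMp : 0 < INR M) by (apply lt_0_INR; lia).
  assert (Hk : 0 < d / INR M) by (apply Rdiv_lt_0_compat; lra).
  eapply Rle_trans; [apply (avg_lat_le d M z (fun x => / x) Hd HM)|].
  - intros x y Hx Hy; apply Rinv_le_contravar; lra.
  - intros x Hx; left; now apply Rinv_0_lt_compat.
  - apply Rle_trans with (36 / INR M ^ 2 * (INR (2 * M + 1) * (4 / (d / INR M)))).
    + apply Rmult_le_compat_l; [apply Rdiv_le_0_compat; nra|].
      rewrite <- (length_seq (2 * M + 1) 0) at 2; rewrite <- rsum_const.
      apply rsum_le; intros q _; pose proof (pos_INR q).
      apply le_Rdiv; [nra|].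
      replace (4 / (d / INR M) * (d / INR M * (INR q / 2 + 1))) with (2 * INR q + 4) by (field; lra).
      lra.
    + pose proof (INR_2M1 M HM).
      replace (36 / INR M ^ 2 * (INR (2 * M + 1) * (4 / (d / INR M))))
        with (144 / (d * INR M) * INR (2 * M + 1)) by (field; lra).
      replace (432 / d) with (144 / (d * INR M) * (3 * INR M)) by (field; lra).
      apply Rmult_le_compat_l; [apply Rdiv_le_0_compat; nra|lra].
Qed.

(** Discrete form of the planar integral of [1 / (x (x + T))], where the singularity [1 / x^2] is
    tamed below scale [T]; hence a logarithm of [d / T] and no dependence on [M]. *)
Lemma avg_lat_inv_inv d M z T : 0 < d -> (1 <= M)%nat -> 0 < T ->
  avg (fun s => / ((Cmod (z - s)%C + d / INR M) * (Cmod (z - s)%C + d / INR M + T))) (lat d M)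
  <= 288 / d ^ 2 * ln (1 + 3 * d / T).
Proof.
  intros Hd HM HT.
  assert (HMp : 0 < INR M) by (apply lt_0_INR; lia).
  assert (Hk : 0 < d / INR M) by (apply Rdiv_lt_0_compat; lra).
  eapply Rle_trans; [apply (avg_lat_le d M z (fun x => / (x * (x + T))) Hd HM)|].
  - intros x y Hx Hy; apply Rinv_le_contravar; nra.
  - intros x Hx; left; apply Rinv_0_lt_compat; nra.
  - set (k := d / INR M) in *.
    assert (HX : 0 < 2 * T / k) by (apply Rdiv_lt_0_compat; lra).
    apply Rle_trans with (36 / INR M ^ 2 * (8 / k ^ 2 * ln (1 + INR (2 * M + 1) / (2 * T / k)))).
    + apply Rmult_le_compat_l; [apply Rdiv_le_0_compat; nra|].
      eapply Rle_trans; [|apply Rmult_le_compat_l; [apply Rdiv_le_0_compat; nra|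
                          apply rsum_inv_le; exact HX]].
      rewrite <- rsum_scal; apply rsum_le; intros q _; pose proof (pos_INR q).
      apply le_Rdiv; [apply Rmult_lt_0_compat; nra|].
      replace (8 / k ^ 2 * / (INR q + 1 + 2 * T / k) * (k * (INR q / 2 + 1) * (k * (INR q / 2 + 1) + T)))
        with ((4 * (INR q / 2 + 1)) * ((k * (INR q + 2) + 2 * T) / (k * (INR q + 1) + 2 * T)))
        by (field; repeat split; nra).
      assert (1 <= (k * (INR q + 2) + 2 * T) / (k * (INR q + 1) + 2 * T)).
      { apply Rmult_le_reg_r with (k * (INR q + 1) + 2 * T); [nra|].
        unfold Rdiv; rewrite Rmult_assoc, Rinv_l; nra. }
      nra.
    + replace (288 / d ^ 2) with (36 / INR M ^ 2 * (8 / k ^ 2)) by (unfold k; field; lra).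
      rewrite Rmult_assoc; apply Rmult_le_compat_l; [apply Rdiv_le_0_compat; nra|].
      apply Rmult_le_compat_l; [apply Rdiv_le_0_compat; nra|].
      assert (0 <= INR (2 * M + 1) / (2 * T / k)) by (apply Rdiv_le_0_compat; [apply pos_INR|lra]).
      apply ln_le; [lra|].
      apply Rplus_le_compat_l.
      replace (3 * d / T) with (6 * INR M / (2 * T / k)) by (unfold k; field; repeat split; nra).
      apply Rmult_le_compat_r; [left; now apply Rinv_0_lt_compat|].
      pose proof (INR_2M1 M HM); lra.
Qed.

Lemma avg_lat_inv2 d M z : 0 < d -> (1 <= M)%nat ->
  avg (fun s => / (Cmod (z - s)%C + d / INR M) ^ 2) (lat d M)
  <= 576 / d ^ 2 * ln (1 + 3 * INR M).
Proof.
  intros Hd HM.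
  assert (HMp : 0 < INR M) by (apply lt_0_INR; lia).
  assert (Hk : 0 < d / INR M) by (apply Rdiv_lt_0_compat; lra).
  pose proof (avg_lat_inv_inv d M z (d / INR M) Hd HM Hk) as H.
  replace (3 * d / (d / INR M)) with (3 * INR M) in H by (field; lra).
  eapply Rle_trans; [|apply Rle_trans with (1 := Rmult_le_compat_l 2 _ _ ltac:(lra) H);
                      right; field; lra].
  rewrite <- avg_scal; apply avg_le; intros s _.
  pose proof (Cmod_ge_0 (z - s)%C) as Hs.
  set (k := d / INR M) in *; set (D := Cmod (z - s)%C) in *.
  replace (2 * / ((D + k) * (D + k + k))) with (/ ((D + k) * (D + 2 * k) / 2)) by (field; nra).
  apply Rinv_le_contravar; nra.
Qed.

(** [1 / x^3] is summable at infinity in the plane, so the few points within reach [k = d / M] of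
    [z] dominate, with weight [M^-2] and value [k^-3]. *)
Lemma avg_lat_inv3 d M z : 0 < d -> (1 <= M)%nat ->
  avg (fun s => / (Cmod (z - s)%C + d / INR M) ^ 3) (lat d M)
  <= 576 * INR M / d ^ 3.
Proof.
  intros Hd HM.
  assert (HMp : 0 < INR M) by (apply lt_0_INR; lia).
  assert (Hk : 0 < d / INR M) by (apply Rdiv_lt_0_compat; lra).
  eapply Rle_trans; [apply (avg_lat_le d M z (fun x => / x ^ 3) Hd HM)|].
  - intros x y Hx Hy; apply Rinv_le_contravar; [now apply pow_lt | apply pow_incr; lra].
  - intros x Hx; left; now apply Rinv_0_lt_compat, pow_lt.
  - set (k := d / INR M) in *.
    replace (576 * INR M / d ^ 3) with (36 / INR M ^ 2 * (16 / k ^ 3 * 1)) by (unfold k; field; lra).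
    apply Rmult_le_compat_l; [apply Rdiv_le_0_compat; nra|].
    assert (Hk3 : 0 < k ^ 3) by now apply pow_lt.
    eapply Rle_trans; [|apply Rmult_le_compat_l;
      [apply Rdiv_le_0_compat; lra | apply Rle_trans with (1 := rsum_inv_sqr_le (2 * M + 1))]].
    + rewrite <- rsum_scal; apply rsum_le; intros q _; pose proof (pos_INR q).
      apply le_Rdiv; [apply pow_lt; nra|].
      replace (16 / k ^ 3 * / (INR q + 2) ^ 2 * (k * (INR q / 2 + 1)) ^ 3)
        with (2 * (INR q + 2)) by (field; lra).
      lra.
    + assert (0 < / (INR (2 * M + 1) + 1)); [|lra].
      apply Rinv_0_lt_compat; pose proof (pos_INR (2 * M + 1)); lra.
Qed.

(** * The averaged kernel *)

(** The Cauchy kernel [1 / z] smoothed at scale [k]: twice the [z]-derivative of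
    [/ 2 * ln (|z|^2 + k^2)]. *)
Definition ker (k : R) (z : C) : C := (Cconj z / RtoC (Cmod z ^ 2 + k ^ 2))%C.

Lemma RtoC_neq0 x : x <> 0 -> RtoC x <> 0%C.
Proof. intros H E; apply H; now apply RtoC_inj. Qed.

Lemma Cmod_pos_RtoC x : 0 <= x -> Cmod (RtoC x) = x.
Proof. intros H; rewrite Cmod_R; now apply Rabs_pos_eq. Qed.

Lemma RtoC_den k z : RtoC (Cmod z ^ 2 + k ^ 2) = (z * Cconj z + RtoC (k ^ 2))%C.
Proof. now rewrite RtoC_plus, Cmod2_conj. Qed.

Lemma ker_den_ge k z : 0 < k -> (Cmod z + k) ^ 2 / 2 <= Cmod z ^ 2 + k ^ 2.
Proof.
  intros Hk; pose proof (Cmod_ge_0 z).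
  pose proof (pow2_ge_0 (Cmod z - k)); nra.
Qed.

Lemma ker_den_pos k z : 0 < k -> 0 < Cmod z ^ 2 + k ^ 2.
Proof. intros Hk; pose proof (pow2_ge_0 (Cmod z)); nra. Qed.

Lemma ker_bound k z : 0 < k -> Cmod (ker k z) <= 2 * / (Cmod z + k).
Proof.
  intros Hk; pose proof (ker_den_ge k z Hk) as H; pose proof (ker_den_pos k z Hk) as Hp.
  pose proof (Cmod_ge_0 z) as Hz.
  unfold ker; rewrite Cmod_div by (apply RtoC_neq0; lra).
  rewrite Cmod_conj, Cmod_pos_RtoC by lra.
  apply le_Rdiv; [lra|].
  apply Rle_trans with (2 * / (Cmod z + k) * ((Cmod z + k) ^ 2 / 2)).
  - replace (2 * / (Cmod z + k) * ((Cmod z + k) ^ 2 / 2)) with (Cmod z + k) by (field; lra); lra.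
  - apply Rmult_le_compat_l; [|lra].
    assert (0 < / (Cmod z + k)) by (apply Rinv_0_lt_compat; lra); lra.
Qed.

(** The model is [1 / z - 1 / w = (w - z) / (z w)]: over a common denominator the numerator still
    carries a factor [z - w] or its conjugate, and each smoothed denominator costs a factor 2. *)
Lemma ker_diff k z w : 0 < k ->
  Cmod (ker k z - ker k w) <= 4 * (Cmod (z - w) / ((Cmod z + k) * (Cmod w + k))).
Proof.
  intros Hk.
  pose proof (ker_den_ge k z Hk) as Hz; pose proof (ker_den_pos k z Hk) as Hzp.
  pose proof (ker_den_ge k w Hk) as Hw; pose proof (ker_den_pos k w Hk) as Hwp.
  pose proof (Cmod_ge_0 z) as Hz0; pose proof (Cmod_ge_0 w) as Hw0.
  set (qz := Cmod z ^ 2 + k ^ 2) in *; set (qw := Cmod w ^ 2 + k ^ 2) in *.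
  assert (E : (ker k z - ker k w)%C
    = ((Cconj z * Cconj w * (w - z) + RtoC (k ^ 2) * (Cconj z - Cconj w)) / (RtoC qz * RtoC qw))%C).
  { unfold ker; fold qz; fold qw.
    assert (N1 : RtoC qz <> 0%C) by (apply RtoC_neq0; lra).
    assert (N2 : RtoC qw <> 0%C) by (apply RtoC_neq0; lra).
    replace (Cconj z * Cconj w * (w - z) + RtoC (k ^ 2) * (Cconj z - Cconj w))%C
      with (Cconj z * RtoC qw - Cconj w * RtoC qz)%C
      by (unfold qz, qw; rewrite !RtoC_den; ring).
    field; now split. }
  rewrite E, Cmod_div by (apply Cmult_neq_0; apply RtoC_neq0; lra).
  rewrite Cmod_mult, !Cmod_pos_RtoC by lra.
  assert (Hn : Cmod (Cconj z * Cconj w * (w - z) + RtoC (k ^ 2) * (Cconj z - Cconj w))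
    <= Cmod (z - w) * ((Cmod z + k) * (Cmod w + k))).
  { eapply Rle_trans; [apply Cmod_triangle|].
    rewrite <- Cminus_conj.
    rewrite !Cmod_mult, !Cmod_conj, Cmod_pos_RtoC by nra.
    replace (w - z)%C with (- (z - w))%C by ring; rewrite Cmod_opp.
    pose proof (Cmod_ge_0 (z - w)); set (t := Cmod (z - w)) in *.
    assert (0 <= t * (k * (Cmod z + Cmod w))) by (apply Rmult_le_pos; nra).
    nra. }
  apply le_Rdiv; [now apply Rmult_lt_0_compat|].
  eapply Rle_trans; [exact Hn|].
  pose proof (Cmod_ge_0 (z - w)) as Ht; set (t := Cmod (z - w)) in *.
  set (a := Cmod z + k) in *; set (b := Cmod w + k) in *.
  assert (Ha : 0 < a) by (unfold a; lra); assert (Hb : 0 < b) by (unfold b; lra).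
  apply Rle_trans with (4 * (t / (a * b)) * (a ^ 2 / 2 * (b ^ 2 / 2))).
  - right; field; lra.
  - apply Rmult_le_compat_l.
    + apply Rmult_le_pos; [lra|]; apply Rdiv_le_0_compat; [lra|now apply Rmult_lt_0_compat].
    + pose proof (pow_lt a 2 Ha); pose proof (pow_lt b 2 Hb); apply Rmult_le_compat; lra.
Qed.

Lemma ker_inv k (z : C) : z <> 0%C -> Cmod (ker k z - / z) <= k ^ 2 / Cmod z ^ 3.
Proof.
  intros Hz; assert (Hp : 0 < Cmod z) by exact (proj1 (Cmod_gt_0 z) Hz).
  assert (Hq : 0 < Cmod z ^ 2 + k ^ 2) by (pose proof (pow2_ge_0 k); nra).
  assert (N1 : RtoC (Cmod z ^ 2 + k ^ 2) <> 0%C) by (apply RtoC_neq0; lra).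
  assert (E : (ker k z - / z)%C = (- (RtoC (k ^ 2)) / (RtoC (Cmod z ^ 2 + k ^ 2) * z))%C).
  { unfold ker.
    replace (- RtoC (k ^ 2))%C with (Cconj z * z - RtoC (Cmod z ^ 2 + k ^ 2))%C
      by (rewrite RtoC_den; ring).
    field; now repeat split. }
  rewrite E, Cmod_div by (now apply Cmult_neq_0).
  rewrite Cmod_opp, Cmod_mult, !Cmod_pos_RtoC by (try apply pow2_ge_0; lra).
  apply Rmult_le_compat_l; [apply pow2_ge_0|].
  apply Rinv_le_contravar; [now apply pow_lt|].
  pose proof (pow2_ge_0 k); nra.
Qed.

(** If [a <= b] then [t a <= T b] and [t T <= 2 T b], so [t (a + T) <= 3 T b]. The point is to
    separate [a] from [b], the smoothed distances of a lattice point to [z] and to [w], so that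
    [avg_lat_inv_inv] applies to each. *)
Lemma inv_mult_le_inv_add a b t T : 0 < a -> 0 < b -> 0 <= t <= T -> t <= a + b -> 0 < T ->
  t / (a * b) <= 3 * T * (/ (a * (a + T)) + / (b * (b + T))).
Proof.
  assert (Hmain : forall a b, 0 < a -> a <= b -> 0 <= t <= T -> t <= a + b -> 0 < T ->
            t / (a * b) <= 3 * T * / (a * (a + T))).
  { clear a b; intros a b Ha Hab Ht Htab HT.
    apply le_Rdiv; [nra|].
    replace (3 * T * / (a * (a + T)) * (a * b)) with (3 * T * b / (a + T)) by (field; lra).
    apply Rmult_le_reg_r with (a + T); [lra|].
    unfold Rdiv; rewrite Rmult_assoc, Rinv_l by lra; nra. }
  intros Ha Hb Ht Htab HT.
  assert (0 < / (a * (a + T))) by (apply Rinv_0_lt_compat; nra).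
  assert (0 < / (b * (b + T))) by (apply Rinv_0_lt_compat; nra).
  destruct (Rle_dec a b).
  - specialize (Hmain a b Ha ltac:(lra) Ht Htab HT); nra.
  - specialize (Hmain b a Hb ltac:(lra) Ht ltac:(lra) HT); rewrite (Rmult_comm b a) in Hmain; nra.
Qed.

(** Smoothed Cauchy transform of the normalized counting measure on the lattice. *)
Definition Hav (d : R) (M : nat) (z : C) : C :=
  avgC (fun s => ker (d / INR M) (z - s)%C) (lat d M).

Lemma lat_step_pos d M : 0 < d -> (1 <= M)%nat -> 0 < d / INR M <= d.
Proof.
  intros Hd HM.
  assert (1 <= INR M) by (apply (le_INR 1); lia).
  split; [apply Rdiv_lt_0_compat; lra | apply le_Rdiv; nra].
Qed.

Lemma Hav_bound d M z : 0 < d -> (1 <= M)%nat -> Cmod (Hav d M z) <= 864 / d.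
Proof.
  intros Hd HM; destruct (lat_step_pos d M Hd HM) as [Hk _].
  unfold Hav; eapply Rle_trans; [apply Cmod_avgC_le; intros s _; apply ker_bound; exact Hk|].
  rewrite avg_scal; pose proof (avg_lat_inv d M z Hd HM).
  replace (864 / d) with (2 * (432 / d)) by (field; lra); lra.
Qed.

Lemma Cmod_minus_ge z s : Cmod z - Cmod s <= Cmod (z - s).
Proof.
  pose proof (Cmod_triangle (z - s) s) as H.
  replace (z - s + s)%C with z in H by ring; lra.
Qed.

(** From distance [2 d] the measure looks like a unit mass at the origin. Since
    [|z - s| >= |z| / 2], smoothing costs [4 d / |z|^2] and moving [s] to 0 costs [2 d / |z|^2]. *)
Lemma Hav_far d M z : 0 < d -> (1 <= M)%nat -> 2 * d <= Cmod z ->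
  Cmod (Hav d M z - / z) <= 6 * d / Cmod z ^ 2.
Proof.
  intros Hd HM Hz; destruct (lat_step_pos d M Hd HM) as [Hk Hkd].
  pose proof (lat_neq_nil d M Hd HM) as Hne.
  unfold Hav; rewrite <- (avgC_const (/ z)%C (lat d M) Hne).
  rewrite <- (avg_const (6 * d / Cmod z ^ 2) (lat d M) Hne).
  apply Cmod_avgC_minus_le; intros s Hs.
  apply lat_Cmod in Hs; [|assumption..].
  pose proof (Cmod_minus_ge z s) as Hzs.
  set (e := (z - s)%C) in *; set (k := d / INR M) in *.
  assert (He : e <> 0%C) by (apply Cmod_gt_0; lra).
  assert (Hz0 : z <> 0%C) by (apply Cmod_gt_0; lra).
  pose proof (ker_inv k e He) as H1.
  assert (H2 : Cmod (/ e - / z) <= 2 * d / Cmod z ^ 2).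
  { replace (/ e - / z)%C with (s / (e * z))%C.
    - rewrite Cmod_div by (now apply Cmult_neq_0); rewrite Cmod_mult.
      apply le_Rdiv; [nra|].
      replace (2 * d / Cmod z ^ 2 * (Cmod e * Cmod z)) with (d * (2 * Cmod e / Cmod z)) by (field; lra).
      assert (1 <= 2 * Cmod e / Cmod z); [|nra].
      apply Rmult_le_reg_r with (Cmod z); [lra|].
      unfold Rdiv; rewrite Rmult_assoc, Rinv_l; lra.
    - replace s with (z - e)%C by (unfold e; ring); field; now split. }
  assert (H3 : k ^ 2 / Cmod e ^ 3 <= 4 * d / Cmod z ^ 2).
  { apply le_Rdiv; [apply pow_lt; lra|].
    apply Rmult_le_reg_r with (Cmod z ^ 2); [apply pow_lt; lra|].
    replace (4 * d / Cmod z ^ 2 * Cmod e ^ 3 * Cmod z ^ 2) with (d * Cmod e * (4 * Cmod e ^ 2)) by (field; lra).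
    apply Rmult_le_compat; nra. }
  replace (ker k e - / z)%C with ((ker k e - / e) + (/ e - / z))%C by ring.
  eapply Rle_trans; [apply Cmod_triangle|].
  replace (6 * d / Cmod z ^ 2) with (4 * d / Cmod z ^ 2 + 2 * d / Cmod z ^ 2) by (field; lra).
  lra.
Qed.

(** Down to the mesh the measures have density bounded uniformly in [M], hence a log-Lipschitz
    Cauchy transform with constants free of [M]. [T] is an upper bound of the distance rather than
    the distance itself: it stays positive when [z = w]. *)
Lemma Hav_diff d M z w T : 0 < d -> (1 <= M)%nat -> 0 < T -> Cmod (z - w) <= T ->
  Cmod (Hav d M z - Hav d M w) <= 6912 * T / d ^ 2 * ln (1 + 3 * d / T).
Proof.
  intros Hd HM HT Hzw; destruct (lat_step_pos d M Hd HM) as [Hk Hkd].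
  pose proof (avg_lat_inv_inv d M z T Hd HM HT) as H1.
  pose proof (avg_lat_inv_inv d M w T Hd HM HT) as H2.
  eapply Rle_trans; [apply Cmod_avgC_minus_le with (b := fun s => 12 * T *
     (/ ((Cmod (z - s) + d / INR M) * (Cmod (z - s) + d / INR M + T))
      + / ((Cmod (w - s) + d / INR M) * (Cmod (w - s) + d / INR M + T))))|].
  - intros s _; eapply Rle_trans; [now apply ker_diff|].
    replace (z - s - (w - s))%C with (z - w)%C by ring.
    pose proof (Cmod_ge_0 (z - s)) as G1; pose proof (Cmod_ge_0 (w - s)) as G2.
    pose proof (Cmod_ge_0 (z - w)) as G3.
    assert (G4 : Cmod (z - w) <= Cmod (z - s) + Cmod (w - s)).
    { replace (z - w)%C with ((z - s) + - (w - s))%C by ring.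
      eapply Rle_trans; [apply Cmod_triangle|]; rewrite Cmod_opp; lra. }
    pose proof (inv_mult_le_inv_add (Cmod (z - s) + d / INR M) (Cmod (w - s) + d / INR M)
      (Cmod (z - w)) T ltac:(lra) ltac:(lra) ltac:(lra) ltac:(lra) HT).
    lra.
  - rewrite avg_scal, avg_plus.
    replace (6912 * T / d ^ 2 * ln (1 + 3 * d / T))
      with (12 * T * (288 / d ^ 2 * ln (1 + 3 * d / T) + 288 / d ^ 2 * ln (1 + 3 * d / T))) by (field; lra).
    apply Rmult_le_compat_l; lra.
Qed.

(** Away from the disk every [|z - s|] is at least [|z| / 2], so [ker_diff] loses no logarithm. *)
Lemma Hav_diff_far d M z w : 0 < d -> (1 <= M)%nat -> 2 * d <= Cmod z -> 2 * d <= Cmod w ->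
  Cmod (Hav d M z - Hav d M w) <= 16 * Cmod (z - w) / (Cmod z * Cmod w).
Proof.
  intros Hd HM Hz Hw; destruct (lat_step_pos d M Hd HM) as [Hk Hkd].
  pose proof (lat_neq_nil d M Hd HM) as Hne.
  rewrite <- (avg_const (16 * Cmod (z - w) / (Cmod z * Cmod w)) (lat d M) Hne).
  apply Cmod_avgC_minus_le; intros s Hs.
  apply lat_Cmod in Hs; [|assumption..].
  eapply Rle_trans; [now apply ker_diff|].
  replace (z - s - (w - s))%C with (z - w)%C by ring.
  pose proof (Cmod_minus_ge z s); pose proof (Cmod_minus_ge w s).
  pose proof (Cmod_ge_0 (z - w)) as G3.
  set (t := Cmod (z - w)) in *; set (k := d / INR M) in *.
  replace (16 * t / (Cmod z * Cmod w)) with (4 * (t / (Cmod z / 2 * (Cmod w / 2)))) by (field; lra).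
  apply Rmult_le_compat_l; [lra|].
  apply Rmult_le_compat_l; [lra|].
  apply Rinv_le_contravar; [apply Rmult_lt_0_compat; lra|].
  apply Rmult_le_compat; lra.
Qed.

(** * The averaged logarithm *)

Definition Lav (d : R) (M : nat) (z : C) : R :=
  avg (fun s => / 2 * ln (Cmod (z - s) ^ 2 + (d / INR M) ^ 2)) (lat d M).

Lemma ln_pow2 x : 0 < x -> ln (x ^ 2) = 2 * ln x.
Proof. intros H; rewrite ln_pow by lra; simpl; ring. Qed.

(** The logarithm has an integrable singularity: with [X = max(|z|, d)], each term falls below
    [ln X] by at most [6 + 4 d / (|z - s| + k)], whose average is at most [6 + 4 * 432] by
    [avg_lat_inv]. *)
Lemma Lav_log d M z : 0 < d -> (1 <= M)%nat ->
  Rabs (Lav d M z - ln (Rmax (Cmod z) d)) <= 1800.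
Proof.
  intros Hd HM; destruct (lat_step_pos d M Hd HM) as [Hk Hkd].
  pose proof (lat_neq_nil d M Hd HM) as Hne.
  set (X := Rmax (Cmod z) d).
  assert (HX1 : Cmod z <= X) by apply Rmax_l; assert (HX2 : d <= X) by apply Rmax_r.
  unfold Lav; rewrite <- (avg_const (ln X) (lat d M) Hne), <- avg_minus.
  eapply Rle_trans;
    [apply Rabs_avg_le with (b := fun s => 6 + 4 * d * / (Cmod (z - s) + d / INR M))|].
  - intros s Hs; apply lat_Cmod in Hs; [|assumption..].
    set (k := d / INR M) in *.
    pose proof (ker_den_ge k (z - s)%C Hk) as Hden.
    pose proof (ker_den_pos k (z - s)%C Hk) as Hpos.
    pose proof (Cmod_minus_ge z s) as Hge.
    assert (Hle : Cmod (z - s) <= 2 * X).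
    { replace (z - s)%C with (z + - s)%C by ring.
      eapply Rle_trans; [apply Cmod_triangle|]; rewrite Cmod_opp; lra. }
    pose proof (Cmod_ge_0 (z - s)) as H0.
    set (D := Cmod (z - s) + k) in *.
    assert (HD : 0 < D) by (unfold D; lra).
    assert (HiD : 0 < / D) by now apply Rinv_0_lt_compat.
    apply Rabs_le; split.
    + assert (L1 : 2 * ln (D / 2) <= ln (Cmod (z - s) ^ 2 + k ^ 2)).
      { rewrite <- ln_pow2 by lra; apply ln_le; [apply pow_lt; lra|]; nra. }
      assert (L2 : ln X - ln (D / 2) <= 2 * X / D).
      { rewrite <- ln_div by lra.
        replace (X / (D / 2)) with (2 * X / D) by (field; lra).
        assert (0 < 2 * X / D) by (apply Rdiv_lt_0_compat; lra).
        pose proof (ln_le_sub1 (2 * X / D)); lra. }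
      assert (L3 : 2 * X / D <= 6 + 4 * d * / D); [|lra].
      destruct (Rle_dec (2 * d) (Cmod z)).
      * assert (X = Cmod z) by (unfold X; apply Rmax_left; lra).
        assert (2 * X / D <= 4) by (apply le_Rdiv; unfold D; lra).
        nra.
      * assert (X <= 2 * d) by (unfold X; apply Rmax_lub; lra).
        unfold Rdiv; nra.
    + assert (L1 : ln (Cmod (z - s) ^ 2 + k ^ 2) <= 2 * ln (3 * X)).
      { rewrite <- ln_pow2 by lra; apply ln_le; [lra|].
        assert (Cmod (z - s) ^ 2 <= (2 * X) ^ 2) by (apply pow_incr; lra).
        assert (k ^ 2 <= X ^ 2) by (apply pow_incr; lra); nra. }
      rewrite ln_mult in L1 by lra.
      pose proof (ln_le_sub1 3 ltac:(lra)); nra.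
  - rewrite avg_plus, avg_const, avg_scal by assumption.
    pose proof (avg_lat_inv d M z Hd HM) as H.
    apply Rmult_le_compat_l with (r := 4 * d) in H; [|lra].
    replace (4 * d * (432 / d)) with 1728 in H by (field; lra).
    lra.
Qed.

(** * One step of the construction, pointwise *)

Definition stepP (k : R) (al Z : C) : C := (Z * Z - RtoC (k ^ 2 / 2) * al)%C.
Definition stepD (k : R) (c Z q : C) : C := (RtoC 2 * Z * q - RtoC (k ^ 2 / 2) * c)%C.
Definition stepd (k r : R) : R := k ^ 2 * r / 4.

Lemma Cmod_minus_le z w : Cmod (z - w) <= Cmod z + Cmod w.
Proof.
  replace (z - w)%C with (z + - w)%C by ring.
  eapply Rle_trans; [apply Cmod_triangle|]; rewrite Cmod_opp; lra.
Qed.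

Lemma Cmod_small k al : Cmod al <= 1 -> Cmod (RtoC (k ^ 2 / 2) * al) <= k ^ 2 / 2.
Proof.
  intros H; pose proof (pow2_ge_0 k).
  rewrite Cmod_mult, Cmod_pos_RtoC by lra; pose proof (Cmod_ge_0 al); nra.
Qed.

Lemma stepP_ge k al Z : Cmod al <= 1 -> Cmod Z ^ 2 - k ^ 2 / 2 <= Cmod (stepP k al Z).
Proof.
  intros H; pose proof (Cmod_small k al H); unfold stepP.
  pose proof (Cmod_minus_ge (Z * Z) (RtoC (k ^ 2 / 2) * al)) as H1.
  rewrite Cmod_mult in H1; nra.
Qed.

Lemma stepP_le k al Z : Cmod al <= 1 -> Cmod (stepP k al Z) <= Cmod Z ^ 2 + k ^ 2 / 2.
Proof.
  intros H; pose proof (Cmod_small k al H); unfold stepP.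
  pose proof (Cmod_minus_le (Z * Z) (RtoC (k ^ 2 / 2) * al)) as H1.
  rewrite Cmod_mult in H1; nra.
Qed.

Lemma stepD_le k c Z q B : Cmod c <= 1 -> Cmod q <= B ->
  Cmod (stepD k c Z q) <= 2 * Cmod Z * B + k ^ 2 / 2.
Proof.
  intros H Hq; pose proof (Cmod_small k c H); unfold stepD.
  pose proof (Cmod_minus_le (RtoC 2 * Z * q) (RtoC (k ^ 2 / 2) * c)) as H1.
  rewrite !Cmod_mult in H1; rewrite (Cmod_pos_RtoC 2) in H1 by lra.
  pose proof (Cmod_ge_0 Z); pose proof (Cmod_ge_0 q).
  rewrite <- Cmod_mult in H1; nra.
Qed.

Lemma stepP_diff k al1 al2 Z1 Z2 :
  Cmod (stepP k al1 Z1 - stepP k al2 Z2)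
  <= Cmod (Z1 - Z2) * (Cmod Z1 + Cmod Z2) + k ^ 2 / 2 * Cmod (al1 - al2).
Proof.
  unfold stepP.
  replace (Z1 * Z1 - RtoC (k ^ 2 / 2) * al1 - (Z2 * Z2 - RtoC (k ^ 2 / 2) * al2))%C
    with ((Z1 - Z2) * (Z1 + Z2) - RtoC (k ^ 2 / 2) * (al1 - al2))%C by ring.
  eapply Rle_trans; [apply Cmod_minus_le|].
  pose proof (pow2_ge_0 k).
  rewrite !Cmod_mult, Cmod_pos_RtoC by lra.
  apply Rplus_le_compat_r, Rmult_le_compat_l; [apply Cmod_ge_0 | apply Cmod_triangle].
Qed.

Lemma stepD_diff k c Z1 Z2 q1 q2 :
  Cmod (stepD k c Z1 q1 - stepD k c Z2 q2)
  <= 2 * (Cmod (Z1 - Z2) * Cmod q1 + Cmod Z2 * Cmod (q1 - q2)).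
Proof.
  unfold stepD.
  replace (RtoC 2 * Z1 * q1 - RtoC (k ^ 2 / 2) * c - (RtoC 2 * Z2 * q2 - RtoC (k ^ 2 / 2) * c))%C
    with (RtoC 2 * ((Z1 - Z2) * q1 + Z2 * (q1 - q2)))%C by ring.
  rewrite Cmod_mult, Cmod_pos_RtoC by lra.
  apply Rmult_le_compat_l; [lra|].
  eapply Rle_trans; [apply Cmod_triangle|]; rewrite !Cmod_mult; lra.
Qed.

Lemma Rdiv_le_compat a b c d : 0 <= a <= c -> 0 < d <= b -> a / b <= c / d.
Proof.
  intros Ha Hb; apply Rmult_le_compat; [lra | | lra | apply Rinv_le_contravar; lra].
  left; apply Rinv_0_lt_compat; lra.
Qed.

(** With [inv_near], brings bounds in [x] for [x >= 2 k] and bounds in [k] for [x < 2 k] to the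
    single form [(x + k)^-n] that the lattice averages accept. *)
Lemma inv_far k x n : 0 < k -> 2 * k <= x -> / x ^ n <= (3 / 2) ^ n / (x + k) ^ n.
Proof.
  intros Hk Hx.
  assert (Hn : 0 < (x + k) ^ n) by (apply pow_lt; lra).
  assert (Hm : 0 < x ^ n) by (apply pow_lt; lra).
  apply Rmult_le_reg_r with (x ^ n * (x + k) ^ n); [now apply Rmult_lt_0_compat|].
  replace (/ x ^ n * (x ^ n * (x + k) ^ n)) with ((x + k) ^ n) by (field; lra).
  replace ((3 / 2) ^ n / (x + k) ^ n * (x ^ n * (x + k) ^ n)) with ((3 / 2 * x) ^ n)
    by (rewrite Rpow_mult_distr; field; lra).
  apply pow_incr; lra.
Qed.

Lemma inv_near k x n : 0 < k -> 0 <= x < 2 * k -> / k ^ n <= 3 ^ n / (x + k) ^ n.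
Proof.
  intros Hk Hx.
  assert (Hn : 0 < (x + k) ^ n) by (apply pow_lt; lra).
  assert (Hm : 0 < k ^ n) by (apply pow_lt; lra).
  apply Rmult_le_reg_r with (k ^ n * (x + k) ^ n); [now apply Rmult_lt_0_compat|].
  replace (/ k ^ n * (k ^ n * (x + k) ^ n)) with ((x + k) ^ n) by (field; lra).
  replace (3 ^ n / (x + k) ^ n * (k ^ n * (x + k) ^ n)) with ((3 * k) ^ n)
    by (rewrite Rpow_mult_distr; field; lra).
  apply pow_incr; lra.
Qed.

(** For [|Z| >= 2 k] one has [|P| >= |Z|^2 / 2], and passing from the left term to [D / (2 P)], then
    to [q / Z], then to [q] times the kernel costs [O(B k^2 / |Z|^3)] each time. For [|Z| < 2 k]
    nothing cancels: both terms are [O(B / (k r))], which has the order of the right side there; the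
    [1 / r] comes from [Hav_bound] at radius [stepd k r]. *)
Lemma step_sup k r B M (Z q al c : C) :
  0 < k <= 1 / 2 -> 0 < r <= 1 / 10 -> 1 <= B -> (1 <= M)%nat ->
  Cmod q <= B -> Cmod Z <= 2 * B -> Cmod al <= 1 -> Cmod c <= 1 ->
  Cmod (RtoC (/ 2) * stepD k c Z q * Hav (stepd k r) M (stepP k al Z) - q * ker k Z)
  <= 240000 * B * k ^ 2 / r * / (Cmod Z + k) ^ 3.
Proof.
  intros Hk Hr HB HM Hq HZ Hal Hc.
  pose proof (Cmod_ge_0 Z) as HZ0; pose proof (Cmod_ge_0 q) as Hq0.
  assert (Hd : 0 < stepd k r) by (unfold stepd; assert (0 < k ^ 2) by (apply pow_lt; lra); nra).
  assert (Hir : 10 <= / r) by (replace 10 with (/ (1 / 10)) by field; apply Rinv_le_contravar; lra).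
  pose proof (stepD_le k c Z q B Hc Hq) as HD.
  pose proof (Cmod_ge_0 (stepD k c Z q)) as HD0.
  destruct (Rlt_le_dec (Cmod Z) (2 * k)) as [Hn|Hf].
  - pose proof (inv_near k (Cmod Z) 3 ltac:(lra) (conj HZ0 Hn)) as Hi.
    assert (Hp : 0 < (Cmod Z + k) ^ 3) by (apply pow_lt; lra).
    apply Rle_trans with (8700 * B * k ^ 2 / r * / k ^ 3).
    2:{ replace (240000 * B * k ^ 2 / r * / (Cmod Z + k) ^ 3)
          with (240000 / 27 * B * k ^ 2 / r * (3 ^ 3 / (Cmod Z + k) ^ 3)) by (field; lra).
        assert (0 <= B * k ^ 2 / r)
          by (apply Rdiv_le_0_compat; [apply Rmult_le_pos; [lra|apply pow2_ge_0]|lra]).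
        assert (0 < / k ^ 3) by (apply Rinv_0_lt_compat, pow_lt; lra).
        replace (8700 * B * k ^ 2 / r * / k ^ 3) with (8700 * (B * k ^ 2 / r) * / k ^ 3) by (field; lra).
        replace (240000 / 27 * B * k ^ 2 / r * (3 ^ 3 / (Cmod Z + k) ^ 3))
          with (240000 / 27 * (B * k ^ 2 / r) * (3 ^ 3 / (Cmod Z + k) ^ 3)) by (field; lra).
        apply Rmult_le_compat; nra. }
    eapply Rle_trans; [apply Cmod_minus_le|].
    rewrite !Cmod_mult, Cmod_pos_RtoC by lra.
    pose proof (Hav_bound (stepd k r) M (stepP k al Z) Hd HM) as HH.
    pose proof (ker_bound k Z ltac:(lra)) as HK.
    assert (H1 : Cmod (stepD k c Z q) <= 5 * k * B) by nra.
    assert (H2 : / 2 * Cmod (stepD k c Z q) * Cmod (Hav (stepd k r) M (stepP k al Z))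
      <= / 2 * (5 * k * B) * (864 / stepd k r)).
    { apply Rmult_le_compat; [lra | apply Cmod_ge_0 | lra | exact HH]. }
    assert (H3 : Cmod q * Cmod (ker k Z) <= B * (2 * / k)).
    { apply Rmult_le_compat; [lra | apply Cmod_ge_0 | lra |].
      eapply Rle_trans; [exact HK|]; apply Rmult_le_compat_l; [lra|apply Rinv_le_contravar; lra]. }
    replace (/ 2 * (5 * k * B) * (864 / stepd k r)) with (8640 * (B / k) * / r) in H2
      by (unfold stepd; field; lra).
    replace (8700 * B * k ^ 2 / r * / k ^ 3) with (8700 * (B / k) * / r) by (field; lra).
    assert (0 < B / k) by (apply Rdiv_lt_0_compat; lra).
    replace (B * (2 * / k)) with (2 * (B / k)) in H3 by (field; lra).
    nra.
  - pose proof (inv_far k (Cmod Z) 3 ltac:(lra) Hf) as Hi.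
    assert (Hp : 0 < (Cmod Z + k) ^ 3) by (apply pow_lt; lra).
    apply Rle_trans with (4 * B * k ^ 2 * / Cmod Z ^ 3).
    2:{ apply Rle_trans with (4 * B * k ^ 2 * ((3 / 2) ^ 3 / (Cmod Z + k) ^ 3)).
        - apply Rmult_le_compat_l; [|exact Hi].
          apply Rmult_le_pos; [lra|apply pow2_ge_0].
        - replace (4 * B * k ^ 2 * ((3 / 2) ^ 3 / (Cmod Z + k) ^ 3))
            with (27 / 2 * B * k ^ 2 * / (Cmod Z + k) ^ 3) by (field; lra).
          apply Rmult_le_compat_r; [left; now apply Rinv_0_lt_compat|].
          replace (27 / 2 * B * k ^ 2) with (27 / 2 * (B * k ^ 2)) by ring.
          replace (240000 * B * k ^ 2 / r) with (240000 * (B * k ^ 2) * / r) by (field; lra).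
          assert (0 <= B * k ^ 2) by (apply Rmult_le_pos; [lra|apply pow2_ge_0]).
          set (x := B * k ^ 2) in *; nra. }
    pose proof (stepP_ge k al Z Hal) as HP.
    set (P := stepP k al Z) in *; set (D := stepD k c Z q) in *.
    assert (Hk2 : k ^ 2 <= Cmod Z ^ 2 / 4) by nra.
    assert (HZp : 0 < Cmod Z ^ 2) by (apply pow_lt; lra).
    assert (HP2 : Cmod Z ^ 2 / 2 <= Cmod P) by lra.
    assert (Hd2 : 2 * stepd k r <= Cmod P) by (unfold stepd; nra).
    assert (NZ : Z <> 0%C) by (apply Cmod_gt_0; lra).
    assert (NP : P <> 0%C) by (apply Cmod_gt_0; lra).
    pose proof (Hav_far (stepd k r) M P Hd HM Hd2) as HH.
    pose proof (ker_inv k Z NZ) as HK.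
    replace (RtoC (/ 2) * D * Hav (stepd k r) M P - q * ker k Z)%C
      with (RtoC (/ 2) * D * (Hav (stepd k r) M P - / P)
            + ((RtoC (/ 2) * D * / P - q * / Z) - q * (ker k Z - / Z)))%C by ring.
    assert (HD2 : Cmod D <= 3 * B * Cmod Z) by nra.
    assert (A1 : Cmod (RtoC (/ 2) * D * (Hav (stepd k r) M P - / P)) <= B * k ^ 2 * / Cmod Z ^ 3).
    { rewrite !Cmod_mult, Cmod_pos_RtoC by lra.
      apply Rle_trans with (/ 2 * (3 * B * Cmod Z) * (6 * stepd k r / (Cmod Z ^ 2 / 2) ^ 2)).
      - apply Rmult_le_compat; [lra | apply Cmod_ge_0 | lra |].
        eapply Rle_trans; [exact HH|].
        apply Rdiv_le_compat; [lra|]; split; [apply pow_lt; lra | apply pow_incr; lra].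
      - replace (/ 2 * (3 * B * Cmod Z) * (6 * stepd k r / (Cmod Z ^ 2 / 2) ^ 2))
          with (9 * r * (B * k ^ 2 * / Cmod Z ^ 3)) by (unfold stepd; field; lra).
        assert (0 <= B * k ^ 2 * / Cmod Z ^ 3); [|nra].
        apply Rmult_le_pos; [apply Rmult_le_pos; [lra|apply pow2_ge_0]|].
        left; apply Rinv_0_lt_compat, pow_lt; lra. }
    (* The cancellation: [D Z - 2 q P = (k^2 / 2) (2 q al - c Z)], the terms [2 Z^2 q] dropping
       out. *)
    assert (A2 : Cmod (RtoC (/ 2) * D * / P - q * / Z) <= 2 * B * k ^ 2 * / Cmod Z ^ 3).
    { replace (RtoC (/ 2) * D * / P - q * / Z)%C
        with (RtoC (k ^ 2 / 4) * (RtoC 2 * q * al - c * Z) / (P * Z))%C.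
      - rewrite Cmod_div by (now apply Cmult_neq_0).
        rewrite !Cmod_mult, Cmod_pos_RtoC by (pose proof (pow2_ge_0 k); lra).
        assert (HN : Cmod (RtoC 2 * q * al - c * Z) <= 4 * B).
        { eapply Rle_trans; [apply Cmod_minus_le|].
          rewrite !Cmod_mult, Cmod_pos_RtoC by lra.
          pose proof (Cmod_ge_0 al); pose proof (Cmod_ge_0 c); nra. }
        apply Rle_trans with (k ^ 2 / 4 * (4 * B) / (Cmod Z ^ 2 / 2 * Cmod Z)).
        + apply Rdiv_le_compat.
          * pose proof (pow2_ge_0 k); pose proof (Cmod_ge_0 (RtoC 2 * q * al - c * Z)); split; nra.
          * split; nra.
        + right; field; lra.
      - replace (RtoC (k ^ 2 / 4)) with (RtoC (/ 2) * RtoC (k ^ 2 / 2))%C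
          by (rewrite <- RtoC_mult; f_equal; field).
        assert (E2 : (RtoC (/ 2) * RtoC 2)%C = 1%C)
          by (rewrite <- RtoC_mult; f_equal; field).
        replace (RtoC (/ 2) * D * / P - q * / Z)%C
          with ((RtoC (/ 2) * D * Z - q * P) / (P * Z))%C by (field; now split).
        f_equal; unfold D, P, stepD, stepP.
        replace (q * (Z * Z - RtoC (k ^ 2 / 2) * al))%C
          with (RtoC (/ 2) * RtoC 2 * (q * (Z * Z - RtoC (k ^ 2 / 2) * al)))%C
          by (rewrite E2; ring).
        ring. }
    assert (A3 : Cmod (q * (ker k Z - / Z)) <= B * k ^ 2 * / Cmod Z ^ 3).
    { rewrite Cmod_mult, Rmult_assoc; apply Rmult_le_compat; [lra | apply Cmod_ge_0 | lra | exact HK]. }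
    eapply Rle_trans; [apply Cmod_triangle|].
    eapply Rle_trans; [apply Rplus_le_compat_l, Cmod_minus_le|].
    lra.
Qed.

Lemma ln_1_inv_ge1 t : 0 < t <= 1 / 2 -> 1 <= ln (1 + / t).
Proof.
  intros Ht; apply Rle_trans with (ln (exp 1)); [rewrite ln_exp; lra|]; apply ln_le; [apply exp_pos|].
  assert (2 <= / t) by (replace 2 with (/ (1 / 2)) by field; apply Rinv_le_contravar; lra).
  pose proof exp_le_3; lra.
Qed.

(** [B t <= k / 4] makes [Z2] follow [Z1] closely enough for [Z1] alone to decide the regime. For
    [|Z1| >= 2 k] the field behaves like [q / Z] and varies by [O(B^2 t / |Z1|^2)]. For [|Z1| < 2 k]
    the log-Lipschitz bound of [Hav] at radius [stepd k r] is used, and its [1 / (stepd k r)^2]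
    produces the [1 / r^2]. *)
Lemma step_osc k r B M t (Z1 Z2 q1 q2 al1 al2 c : C) :
  0 < k <= 1 / 2 -> 0 < r <= 1 / 10 -> 1 <= B -> (1 <= M)%nat ->
  0 < t -> B * t <= k / 4 ->
  Cmod q1 <= B -> Cmod q2 <= B -> Cmod Z1 <= 2 * B -> Cmod Z2 <= 2 * B ->
  Cmod al1 <= 1 -> Cmod al2 <= 1 -> Cmod c <= 1 ->
  Cmod (Z1 - Z2) <= B * t -> Cmod (q1 - q2) <= B * t -> Cmod (al1 - al2) <= 2 * t ->
  Cmod (RtoC (/ 2) * stepD k c Z1 q1 * Hav (stepd k r) M (stepP k al1 Z1)
        - RtoC (/ 2) * stepD k c Z2 q2 * Hav (stepd k r) M (stepP k al2 Z2))
  <= 1350 * B ^ 2 * t * / (Cmod Z1 + k) ^ 2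
     + 40000000 * B ^ 2 * k * t / r ^ 2 * ln (1 + / t) * / (Cmod Z1 + k) ^ 3.
Proof.
  intros Hk Hr HB HM Ht HBt Hq1 Hq2 HZ1 HZ2 Hal1 Hal2 Hc HdZ Hdq Hdal.
  pose proof (Cmod_ge_0 Z1) as HZ10; pose proof (Cmod_ge_0 Z2) as HZ20.
  pose proof (Cmod_ge_0 q1) as Hq10; pose proof (Cmod_ge_0 (Z1 - Z2)) as HdZ0.
  pose proof (Cmod_ge_0 (q1 - q2)) as Hdq0; pose proof (Cmod_ge_0 (al1 - al2)) as Hdal0.
  assert (Hd : 0 < stepd k r) by (unfold stepd; assert (0 < k ^ 2) by (apply pow_lt; lra); nra).
  assert (Ht8 : t <= 1 / 8) by nra.
  pose proof (ln_1_inv_ge1 t ltac:(lra)) as Hln.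
  pose proof (Cmod_minus_ge Z1 (Z1 - Z2)) as HZ21.
  replace (Z1 - (Z1 - Z2))%C with Z2 in HZ21 by ring.
  pose proof (Cmod_minus_ge Z2 (Z2 - Z1)) as HZ12.
  replace (Z2 - (Z2 - Z1))%C with Z1 in HZ12 by ring.
  replace (Z2 - Z1)%C with (- (Z1 - Z2))%C in HZ12 by ring; rewrite Cmod_opp in HZ12.
  pose proof (stepD_le k c Z2 q2 B Hc Hq2) as HD2.
  pose proof (stepD_diff k c Z1 Z2 q1 q2) as HdD.
  pose proof (stepP_diff k al1 al2 Z1 Z2) as HdP.
  pose proof (stepP_ge k al1 Z1 Hal1) as HP1; pose proof (stepP_ge k al2 Z2 Hal2) as HP2.
  assert (HdD' : Cmod (stepD k c Z1 q1 - stepD k c Z2 q2) <= 6 * B ^ 2 * t).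
  { eapply Rle_trans; [exact HdD|].
    assert (Cmod (Z1 - Z2) * Cmod q1 <= B * t * B) by (apply Rmult_le_compat; lra).
    assert (Cmod Z2 * Cmod (q1 - q2) <= 2 * B * (B * t)) by (apply Rmult_le_compat; lra).
    nra. }
  set (P1 := stepP k al1 Z1) in *; set (P2 := stepP k al2 Z2) in *.
  set (D1 := stepD k c Z1 q1) in *; set (D2 := stepD k c Z2 q2) in *.
  set (H1 := Hav (stepd k r) M P1); set (H2 := Hav (stepd k r) M P2).
  assert (Hk2 : 0 < k ^ 2) by (apply pow_lt; lra).
  assert (HB2t : 0 < B ^ 2 * t) by (apply Rmult_lt_0_compat; [apply pow_lt; lra|lra]).
  replace (RtoC (/ 2) * D1 * H1 - RtoC (/ 2) * D2 * H2)%C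
    with (RtoC (/ 2) * (D1 - D2) * H1 + RtoC (/ 2) * D2 * (H1 - H2))%C by ring.
  eapply Rle_trans; [apply Cmod_triangle|].
  rewrite !Cmod_mult, Cmod_pos_RtoC by lra.
  assert (Hir : 1 <= / r).
  { rewrite <- Rinv_1 at 1; apply Rinv_le_contravar; lra. }
  assert (Hfirst : 0 <= 1350 * B ^ 2 * t * / (Cmod Z1 + k) ^ 2).
  { apply Rmult_le_pos; [nra|]; left; apply Rinv_0_lt_compat, pow_lt; lra. }
  assert (Hsecond : 0 <= 40000000 * B ^ 2 * k * t / r ^ 2 * ln (1 + / t) * / (Cmod Z1 + k) ^ 3).
  { apply Rmult_le_pos; [apply Rmult_le_pos; [|lra]|].
    - apply Rdiv_le_0_compat; [|apply pow_lt; lra].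
      replace (40000000 * B ^ 2 * k * t) with (40000000 * (B ^ 2 * t) * k) by ring; nra.
    - left; apply Rinv_0_lt_compat, pow_lt; lra. }
  destruct (Rlt_le_dec (Cmod Z1) (2 * k)) as [Hn|Hf].
  - match goal with |- ?x <= _ => enough (Hx : x <= 40000000 * B ^ 2 * k * t / r ^ 2 * ln (1 + / t) * / (Cmod Z1 + k) ^ 3) by lra end.
    pose proof (inv_near k (Cmod Z1) 3 ltac:(lra) (conj HZ10 Hn)) as Hi.
    assert (Hp : 0 < (Cmod Z1 + k) ^ 3) by (apply pow_lt; lra).
    apply Rle_trans with (1400000 * (B ^ 2 * t) * k * (/ r) ^ 2 * ln (1 + / t) * / k ^ 3).
    2:{ replace (40000000 * B ^ 2 * k * t / r ^ 2 * ln (1 + / t) * / (Cmod Z1 + k) ^ 3)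
          with (40000000 / 27 * (B ^ 2 * t) * k * (/ r) ^ 2 * ln (1 + / t) * (3 ^ 3 / (Cmod Z1 + k) ^ 3))
          by (field; lra).
        assert (0 <= (B ^ 2 * t) * k * (/ r) ^ 2 * ln (1 + / t)).
        { apply Rmult_le_pos; [|lra]; apply Rmult_le_pos; [nra|apply pow2_ge_0]. }
        assert (0 < / k ^ 3) by (apply Rinv_0_lt_compat, pow_lt; lra).
        apply Rmult_le_compat; [nra | lra | nra | exact Hi]. }
    pose proof (Hav_bound (stepd k r) M P1 Hd HM) as HH1; fold H1 in HH1.
    assert (HZ2k : Cmod Z2 <= 9 / 4 * k) by lra.
    assert (HD2k : Cmod D2 <= 5 * k * B) by nra.
    assert (HdPk : Cmod (P1 - P2) <= 5 * B * k * t).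
    { eapply Rle_trans; [exact HdP|].
      assert (Cmod (Z1 - Z2) * (Cmod Z1 + Cmod Z2) <= B * t * (17 / 4 * k))
        by (apply Rmult_le_compat; lra).
      assert (k ^ 2 / 2 * Cmod (al1 - al2) <= k ^ 2 / 2 * (2 * t)) by (apply Rmult_le_compat_l; lra).
      assert (k * (k * t) <= 1 / 2 * (k * t)) by (apply Rmult_le_compat_r; nra).
      assert (k * t <= B * (k * t)) by (assert (0 < k * t) by nra; nra).
      nra. }
    assert (HT : 0 < 5 * B * k * t) by (apply Rmult_lt_0_compat; nra).
    pose proof (Hav_diff (stepd k r) M P1 P2 _ Hd HM HT HdPk) as HH; fold H1 H2 in HH.
    (* One factor [k] of [stepd k r] cancels against the [k] in [5 B k t], so the argument of the
       logarithm is controlled by [1 / t] alone. *)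
    assert (Hll : ln (1 + 3 * stepd k r / (5 * B * k * t)) <= ln (1 + / t)).
    { assert (Hpos : 0 < 3 * stepd k r / (5 * B * k * t)) by (apply Rdiv_lt_0_compat; lra).
      apply ln_le; [lra|].
      apply Rplus_le_compat_l.
      apply le_Rdiv; [exact HT|].
      replace (/ t * (5 * B * k * t)) with (5 * B * k) by (field; lra).
      unfold stepd; nra. }
    assert (T1 : / 2 * Cmod (D1 - D2) * Cmod H1 <= / 2 * (6 * B ^ 2 * t) * (864 / stepd k r)).
    { apply Rmult_le_compat; [pose proof (Cmod_ge_0 (D1 - D2)); lra | apply Cmod_ge_0 | lra | exact HH1]. }
    assert (T2 : / 2 * Cmod D2 * Cmod (H1 - H2)
      <= / 2 * (5 * k * B) * (6912 * (5 * B * k * t) / stepd k r ^ 2 * ln (1 + / t))).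
    { apply Rmult_le_compat; [pose proof (Cmod_ge_0 D2); lra | apply Cmod_ge_0 | lra |].
      eapply Rle_trans; [exact HH|]; apply Rmult_le_compat_l; [|exact Hll].
      apply Rdiv_le_0_compat; [lra|apply pow_lt; lra]. }
    replace (/ 2 * (6 * B ^ 2 * t) * (864 / stepd k r))
      with (10368 * (B ^ 2 * t) * k * / r * 1 * / k ^ 3) in T1 by (unfold stepd; field; lra).
    replace (/ 2 * (5 * k * B) * (6912 * (5 * B * k * t) / stepd k r ^ 2 * ln (1 + / t)))
      with (1382400 * (B ^ 2 * t) * k * (/ r) ^ 2 * ln (1 + / t) * / k ^ 3) in T2
      by (unfold stepd; field; lra).
    assert (T3 : 10368 * (B ^ 2 * t) * k * / r * 1 * / k ^ 3
      <= 10368 * (B ^ 2 * t) * k * (/ r) ^ 2 * ln (1 + / t) * / k ^ 3).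
    { apply Rmult_le_compat_r; [left; apply Rinv_0_lt_compat, pow_lt; lra|].
      assert (0 < 10368 * (B ^ 2 * t) * k) by nra.
      apply Rmult_le_compat; [nra | lra | | lra].
      apply Rmult_le_compat_l; nra. }
    replace (1400000 * (B ^ 2 * t) * k * (/ r) ^ 2 * ln (1 + / t) * / k ^ 3)
      with (1400000 * ((B ^ 2 * t) * k * (/ r) ^ 2 * ln (1 + / t) * / k ^ 3)) by ring.
    assert (0 <= (B ^ 2 * t) * k * (/ r) ^ 2 * ln (1 + / t) * / k ^ 3).
    { apply Rmult_le_pos; [|left; apply Rinv_0_lt_compat, pow_lt; lra].
      apply Rmult_le_pos; [|lra]; apply Rmult_le_pos; [nra|apply pow2_ge_0]. }
    nra.
  - match goal with |- ?x <= _ => enough (Hx : x <= 1350 * B ^ 2 * t * / (Cmod Z1 + k) ^ 2) by lra end.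
    pose proof (inv_far k (Cmod Z1) 2 ltac:(lra) Hf) as Hi.
    assert (Hp : 0 < (Cmod Z1 + k) ^ 2) by (apply pow_lt; lra).
    apply Rle_trans with (600 * (B ^ 2 * t) * / Cmod Z1 ^ 2).
    2:{ replace (1350 * B ^ 2 * t * / (Cmod Z1 + k) ^ 2)
          with (600 * (B ^ 2 * t) * ((3 / 2) ^ 2 / (Cmod Z1 + k) ^ 2)) by (field; lra).
        apply Rmult_le_compat_l; lra. }
    assert (HZ2f : 7 / 8 * Cmod Z1 <= Cmod Z2 <= 9 / 8 * Cmod Z1) by lra.
    assert (Hk4 : k ^ 2 <= Cmod Z1 ^ 2 / 4) by nra.
    assert (HZp : 0 < Cmod Z1 ^ 2) by (apply pow_lt; lra).
    assert (HZ22 : 49 / 64 * Cmod Z1 ^ 2 <= Cmod Z2 ^ 2) by nra.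
    assert (HP1' : Cmod Z1 ^ 2 / 2 <= Cmod P1) by lra.
    assert (HP2' : Cmod Z1 ^ 2 / 3 <= Cmod P2) by lra.
    assert (Hd2 : 2 * stepd k r <= Cmod Z1 ^ 2 / 3) by (unfold stepd; nra).
    assert (NP : P1 <> 0%C) by (apply Cmod_gt_0; lra).
    pose proof (Hav_far (stepd k r) M P1 Hd HM ltac:(lra)) as HF; fold H1 in HF.
    pose proof (Hav_diff_far (stepd k r) M P1 P2 Hd HM ltac:(lra) ltac:(lra)) as HH; fold H1 H2 in HH.
    assert (HH1 : Cmod H1 <= 4 / (Cmod Z1 ^ 2 / 2)).
    { replace H1 with ((H1 - / P1) + / P1)%C by ring.
      eapply Rle_trans; [apply Cmod_triangle|].
      rewrite Cmod_inv by exact NP.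
      apply Rle_trans with (4 / Cmod P1); [|apply Rdiv_le_compat; lra].
      replace (4 / Cmod P1) with (3 / Cmod P1 + / Cmod P1) by (field; lra).
      apply Rplus_le_compat_r; eapply Rle_trans; [exact HF|].
      replace (3 / Cmod P1) with (3 * Cmod P1 / Cmod P1 ^ 2) by (field; lra).
      apply Rmult_le_compat_r; [left; apply Rinv_0_lt_compat, pow_lt; lra|lra]. }
    assert (HD2f : Cmod D2 <= 4 * B * Cmod Z1) by nra.
    assert (HdPf : Cmod (P1 - P2) <= 3 * B * t * Cmod Z1).
    { eapply Rle_trans; [exact HdP|].
      assert (Cmod (Z1 - Z2) * (Cmod Z1 + Cmod Z2) <= B * t * (17 / 8 * Cmod Z1))
        by (apply Rmult_le_compat; lra).
      assert (k ^ 2 / 2 * Cmod (al1 - al2) <= k ^ 2 / 2 * (2 * t)) by (apply Rmult_le_compat_l; lra).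
      assert (k * (k * t) <= 1 / 2 * (k * t)) by (apply Rmult_le_compat_r; nra).
      assert (k * t <= Cmod Z1 / 2 * t) by (apply Rmult_le_compat_r; lra).
      assert (t * Cmod Z1 <= B * (t * Cmod Z1)) by (assert (0 <= t * Cmod Z1) by nra; nra).
      nra. }
    assert (T1 : / 2 * Cmod (D1 - D2) * Cmod H1 <= / 2 * (6 * B ^ 2 * t) * (4 / (Cmod Z1 ^ 2 / 2))).
    { apply Rmult_le_compat; [pose proof (Cmod_ge_0 (D1 - D2)); lra | apply Cmod_ge_0 | lra | exact HH1]. }
    assert (T2 : / 2 * Cmod D2 * Cmod (H1 - H2)
      <= / 2 * (4 * B * Cmod Z1) * (16 * (3 * B * t * Cmod Z1) / (Cmod Z1 ^ 2 / 2 * (Cmod Z1 ^ 2 / 3)))).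
    { apply Rmult_le_compat; [pose proof (Cmod_ge_0 D2); lra | apply Cmod_ge_0 | lra |].
      eapply Rle_trans; [exact HH|].
      apply Rdiv_le_compat; [pose proof (Cmod_ge_0 (P1 - P2)); lra|].
      split; [apply Rmult_lt_0_compat; lra|apply Rmult_le_compat; lra]. }
    replace (/ 2 * (6 * B ^ 2 * t) * (4 / (Cmod Z1 ^ 2 / 2))) with (24 * (B ^ 2 * t) * / Cmod Z1 ^ 2) in T1
      by (field; lra).
    replace (/ 2 * (4 * B * Cmod Z1) * (16 * (3 * B * t * Cmod Z1) / (Cmod Z1 ^ 2 / 2 * (Cmod Z1 ^ 2 / 3))))
      with (576 * (B ^ 2 * t) * / Cmod Z1 ^ 2) in T2 by (field; lra).
    lra.
Qed.

(** * The gradient fields of the smoothed potentials *)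

Lemma avg_le_const {T} (f : T -> R) (c : R) l :
  0 <= c -> (forall x, In x l -> f x <= c) -> avg f l <= c.
Proof.
  intros Hc H; destruct l as [|y l].
  - unfold avg, rsum; simpl; lra.
  - rewrite <- (avg_const c (y :: l)) by discriminate; now apply avg_le.
Qed.

Lemma Cmod_le_pdist (x y : pt) :
  Cmod (fst x - fst y) <= pdist x y /\ Cmod (snd x - snd y) <= pdist x y.
Proof.
  unfold pdist, pnorm; simpl fst; simpl snd.
  change (Defs.Cmod (Csub (fst x) (fst y))) with (Cmod (fst x - fst y)).
  change (Defs.Cmod (Csub (snd x) (snd y))) with (Cmod (snd x - snd y)).
  pose proof (Cmod_ge_0 (fst x - fst y)) as H1; pose proof (Cmod_ge_0 (snd x - snd y)) as H2.
  set (u := Cmod (fst x - fst y)) in *; set (v := Cmod (snd x - snd y)) in *.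
  split; [rewrite <- (sqrt_pow2 u) at 1 by lra | rewrite <- (sqrt_pow2 v) at 1 by lra];
    apply sqrt_le_1_alt; nra.
Qed.

Lemma pdist_le_Cmod (x y : pt) : pdist x y <= Cmod (fst x - fst y) + Cmod (snd x - snd y).
Proof.
  unfold pdist, pnorm; simpl fst; simpl snd.
  change (Defs.Cmod (Csub (fst x) (fst y))) with (Cmod (fst x - fst y)).
  change (Defs.Cmod (Csub (snd x) (snd y))) with (Cmod (snd x - snd y)).
  pose proof (Cmod_ge_0 (fst x - fst y)) as H1; pose proof (Cmod_ge_0 (snd x - snd y)) as H2.
  set (u := Cmod (fst x - fst y)) in *; set (v := Cmod (snd x - snd y)) in *.
  rewrite <- (sqrt_pow2 (u + v)) by lra; apply sqrt_le_1_alt; nra.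
Qed.

Lemma pdist_ge0 x y : 0 <= pdist x y.
Proof. apply sqrt_pos. Qed.

Lemma Afun_bound a n x : Cmod (a n) < 1 / 4 -> Omega x -> Cmod (Afun a n x) <= 1.
Proof.
  intros Ha [H1 H2]; unfold Afun; destruct (Nat.odd n).
  - change (Cmod (fst x - a n) <= 1).
    pose proof (Cmod_minus_le (fst x) (a n)); change (Defs.Cmod (fst x)) with (Cmod (fst x)) in H1; lra.
  - change (Csub (Cadd (fst x) (Cscale (1 / 100) (snd x))) (a n))
      with (fst x + Cscale (1 / 100) (snd x) - a n)%C.
    replace (Cscale (1 / 100) (snd x)) with (RtoC (1 / 100) * snd x)%C
      by (unfold Cscale, Cmult, RtoC; simpl; f_equal; ring).
    pose proof (Cmod_minus_le (fst x + RtoC (1 / 100) * snd x) (a n)) as H.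
    pose proof (Cmod_triangle (fst x) (RtoC (1 / 100) * snd x)) as H'.
    rewrite Cmod_mult, Cmod_pos_RtoC in H' by lra.
    change (Defs.Cmod (fst x)) with (Cmod (fst x)) in H1.
    change (Defs.Cmod (snd x)) with (Cmod (snd x)) in H2; lra.
Qed.

Lemma Afun_diff a n x y : Cmod (Afun a n x - Afun a n y) <= 2 * pdist x y.
Proof.
  destruct (Cmod_le_pdist x y) as [H1 H2].
  pose proof (pdist_ge0 x y) as H3.
  unfold Afun; destruct (Nat.odd n).
  - change (Cmod ((fst x - a n) - (fst y - a n)) <= 2 * pdist x y).
    replace (fst x - a n - (fst y - a n))%C with (fst x - fst y)%C by ring.
    eapply Rle_trans; [exact H1|]; lra.
  - replace (Csub (Cadd (fst x) (Cscale (1 / 100) (snd x))) (a n)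
       - Csub (Cadd (fst y) (Cscale (1 / 100) (snd y))) (a n))%C
      with ((fst x - fst y) + RtoC (1 / 100) * (snd x - snd y))%C
      by (unfold Csub, Cadd, Cscale, Cminus, Cplus, Copp, Cmult, RtoC; simpl; f_equal; ring).
    eapply Rle_trans; [apply Cmod_triangle|].
    rewrite Cmod_mult, Cmod_pos_RtoC by lra.
    eapply Rle_trans; [apply Rplus_le_compat; [exact H1 | apply Rmult_le_compat_l; [lra | exact H2]]|]; lra.
Qed.

(** * Growth of the polynomials and of their derivatives along the tree *)

(** One constant per level for the size and the Lipschitz constant of [P_s] and of its partial
    derivatives. It depends on [n] only, so it is known before any [m] is chosen; the factor 6 is
    what the term [2 Z q] needs in [tree_lip]. *)
Fixpoint Bn (n : nat) : R := match n with O => 1 | S k => 6 * Bn k ^ 2 end.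

Lemma Bn_ge1 n : 1 <= Bn n.
Proof. induction n as [|n IH]; simpl; nra. Qed.

(* [c n] stands for a partial derivative of [A_n] and [d0] for the same partial derivative of [w]. *)
Fixpoint Daux (c : nat -> C) (a : nat -> Cx) (r : nat -> R) (m : nat -> nat) (p : pt)
    (k : nat) (v dv : C) (s : list Cx) : C :=
  match s with
  | [] => dv
  | sg :: s' =>
      Daux c a r m p (S k)
        (Csub (Cmul (Csub v sg) (Csub v sg)) (Cscale (eps r m (S k)) (Afun a (S k) p)))
        (RtoC 2 * (v - sg) * dv - RtoC (eps r m (S k)) * c (S k))%C s'
  end.

Definition Dfun c d0 a r m (s : list Cx) (p : pt) : C := Daux c a r m p 0 (snd p) d0 s.

(** [Paux] consumes a word from its head while the tree grows at the end of words; this moves the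
    recursion to the last letter, whose level is [S (k + length s)]. *)
Lemma Paux_snoc a r m p s sg k v :
  Paux a r m p k v (s ++ [sg])
  = let w := Paux a r m p k v s in
    Csub (Cmul (Csub w sg) (Csub w sg))
      (Cscale (eps r m (S (k + length s))) (Afun a (S (k + length s)) p)).
Proof.
  revert k v; induction s as [|x s IH]; intros k v; simpl.
  - now rewrite Nat.add_0_r.
  - rewrite IH; cbv zeta; now replace (S k + length s)%nat with (k + S (length s))%nat by lia.
Qed.

Lemma Daux_snoc c a r m p s sg k v dv :
  Daux c a r m p k v dv (s ++ [sg])
  = (RtoC 2 * (Paux a r m p k v s - sg) * Daux c a r m p k v dv s
     - RtoC (eps r m (S (k + length s))) * c (S (k + length s)))%C.
Proof.
  revert k v dv; induction s as [|x s IH]; intros k v dv; simpl.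
  - now rewrite Nat.add_0_r.
  - rewrite IH; now replace (S k + length s)%nat with (k + S (length s))%nat by lia.
Qed.

Lemma Slist_length r m n s : In s (Slist r m n) -> length s = n.
Proof.
  revert s; induction n as [|n IH]; intros s H; simpl in H.
  - destruct H as [<-|[]]; reflexivity.
  - apply in_flat_map in H; destruct H as [s' [H1 H2]].
    apply in_map_iff in H2; destruct H2 as [sg [<- _]].
    rewrite length_app, (IH _ H1); simpl; lia.
Qed.

Definition kap (r : nat -> R) (m : nat -> nat) (n : nat) : R := delta r m n / INR (m (S n)).

Lemma eps_kap r m n : (1 <= m (S n))%nat -> eps r m (S n) = kap r m n ^ 2 / 2.
Proof.
  intros H; assert (0 < INR (m (S n))) by (apply lt_0_INR; lia).
  unfold kap, eps; field; lra.
Qed.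

Lemma delta_stepd r m n : (1 <= m (S n))%nat -> delta r m (S n) = stepd (kap r m n) (r (S n)).
Proof.
  intros H; assert (0 < INR (m (S n))) by (apply lt_0_INR; lia).
  unfold kap, stepd; simpl delta; field; lra.
Qed.

Lemma Pfun_snoc a r m n s sg p : (1 <= m (S n))%nat -> In s (Slist r m n) ->
  Pfun a r m (s ++ [sg]) p = stepP (kap r m n) (Afun a (S n) p) (Pfun a r m s p - sg)%C.
Proof.
  intros Hm Hs; unfold Pfun; rewrite Paux_snoc, (Slist_length _ _ _ _ Hs); simpl plus; cbv zeta.
  unfold stepP; rewrite <- eps_kap by assumption.
  unfold Csub, Cmul, Cscale, Cminus, Cmult, Cplus, Copp, RtoC; simpl; f_equal; ring.
Qed.

Lemma Dfun_snoc c d0 a r m n s sg p : (1 <= m (S n))%nat -> In s (Slist r m n) ->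
  Dfun c d0 a r m (s ++ [sg]) p
  = stepD (kap r m n) (c (S n)) (Pfun a r m s p - sg)%C (Dfun c d0 a r m s p).
Proof.
  intros Hm Hs; unfold Dfun; rewrite Daux_snoc, (Slist_length _ _ _ _ Hs); simpl plus.
  unfold stepD; rewrite <- eps_kap by assumption; reflexivity.
Qed.

Section Fields.
Variables (a : nat -> Cx) (r : nat -> R) (m : nat -> nat) (c : nat -> C) (d0 : C).
Hypothesis ha : forall n, (1 <= n)%nat -> Cmod (a n) < 1 / 4.
Hypothesis hr_pos : forall n, (1 <= n)%nat -> 0 < r n.
Hypothesis hr_le : forall n, (1 <= n)%nat -> r n <= 1 / 10.
Hypothesis hm : forall n, (1 <= m n)%nat.
Hypothesis hc : forall n, Cmod (c n) <= 1.
Hypothesis hd0 : Cmod d0 <= 1.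

Let P := Pfun a r m.
Let D := Dfun c d0 a r m.

Lemma delta_bounds n : 0 < delta r m n <= 1 / 2.
Proof.
  induction n as [|n IH]; [simpl; lra|].
  rewrite delta_stepd by apply hm.
  destruct (lat_step_pos (delta r m n) (m (S n)) ltac:(lra) (hm _)) as [H1 H2].
  fold (kap r m n) in H1, H2.
  pose proof (hr_pos (S n) ltac:(lia)); pose proof (hr_le (S n) ltac:(lia)).
  assert (0 < kap r m n ^ 2 <= 1) by (split; [apply pow_lt; lra | nra]).
  unfold stepd; split; nra.
Qed.

Lemma kap_bounds n : 0 < kap r m n <= 1 / 2.
Proof.
  pose proof (delta_bounds n).
  destruct (lat_step_pos (delta r m n) (m (S n)) ltac:(lra) (hm _)) as [H1 H2].
  fold (kap r m n) in H1, H2; lra.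
Qed.

Lemma Sigma_Cmod n sg : In sg (Sigma r m n) -> Cmod sg <= 1 / 2.
Proof.
  intros H; pose proof (delta_bounds n).
  rewrite Sigma_lat in H; apply lat_Cmod in H; [lra | lra | apply hm].
Qed.

Lemma tree_bounds n s : In s (Slist r m n) ->
  forall x, Omega x -> Cmod (P s x) <= Bn n /\ Cmod (D s x) <= Bn n.
Proof.
  revert s; induction n as [|n IH]; intros s Hs x Hx; simpl in Hs.
  - destruct Hs as [<-|[]]; unfold P, D, Pfun, Dfun; simpl; destruct Hx as [_ Hx].
    change (Defs.Cmod (snd x)) with (Cmod (snd x)) in Hx; lra.
  - apply in_flat_map in Hs; destruct Hs as [s' [Hs' H2]].
    apply in_map_iff in H2; destruct H2 as [sg [<- Hsg]].
    apply Sigma_Cmod in Hsg; destruct (IH s' Hs' x Hx) as [HP HD].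
    pose proof (kap_bounds n) as Hk; pose proof (Bn_ge1 n) as HB.
    pose proof (Afun_bound a (S n) x (ha (S n) ltac:(lia)) Hx) as HA.
    unfold P, D; rewrite (Pfun_snoc _ _ _ n), (Dfun_snoc _ _ _ _ _ n) by auto.
    fold P; fold D.
    pose proof (Cmod_minus_le (P s' x) sg) as HZ; pose proof (Cmod_ge_0 (P s' x - sg)).
    pose proof (stepP_le (kap r m n) _ (P s' x - sg)%C HA) as H1.
    pose proof (stepD_le (kap r m n) (c (S n)) (P s' x - sg)%C (D s' x) _ (hc _) HD) as H2.
    simpl Bn; split; nra.
Qed.

Lemma tree_lip n s : In s (Slist r m n) ->
  forall x y, Omega x -> Omega y ->
  Cmod (P s x - P s y) <= Bn n * pdist x y /\ Cmod (D s x - D s y) <= Bn n * pdist x y.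
Proof.
  revert s; induction n as [|n IH]; intros s Hs x y Hx Hy; simpl in Hs.
  - destruct Hs as [<-|[]]; unfold P, D, Pfun, Dfun; simpl.
    destruct (Cmod_le_pdist x y) as [H1 H2].
    replace (d0 - d0)%C with (RtoC 0) by ring; rewrite Cmod_0.
    pose proof (pdist_ge0 x y); split; [|lra].
    eapply Rle_trans; [exact H2|]; lra.
  - apply in_flat_map in Hs; destruct Hs as [s' [Hs' H2]].
    apply in_map_iff in H2; destruct H2 as [sg [<- Hsg]].
    apply Sigma_Cmod in Hsg; destruct (IH s' Hs' x y Hx Hy) as [HP HD].
    destruct (tree_bounds n s' Hs' x Hx) as [HPx HDx].
    destruct (tree_bounds n s' Hs' y Hy) as [HPy HDy].
    pose proof (kap_bounds n) as Hk; pose proof (Bn_ge1 n) as HB.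
    unfold P, D; rewrite !(Pfun_snoc _ _ _ n), !(Dfun_snoc _ _ _ _ _ n) by auto.
    fold P; fold D.
    pose proof (Cmod_minus_le (P s' x) sg) as HZx; pose proof (Cmod_minus_le (P s' y) sg) as HZy.
    pose proof (Afun_diff a (S n) x y) as HA.
    pose proof (pdist_ge0 x y) as Ht.
    set (t := pdist x y) in *; set (B := Bn n) in *.
    pose proof (stepP_diff (kap r m n) (Afun a (S n) x) (Afun a (S n) y) (P s' x - sg)%C (P s' y - sg)%C) as H1.
    pose proof (stepD_diff (kap r m n) (c (S n)) (P s' x - sg)%C (P s' y - sg)%C (D s' x) (D s' y)) as H2.
    replace (P s' x - sg - (P s' y - sg))%C with (P s' x - P s' y)%C in H1, H2 by ring.
    assert (HBt : 0 <= B * t) by (apply Rmult_le_pos; lra).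
    simpl Bn; fold B; replace (6 * (B * (B * 1)) * t) with (6 * B * (B * t)) by ring; split.
    + eapply Rle_trans; [exact H1|].
      apply Rle_trans with (B * t * (4 * B) + 1 / 8 * (2 * t)).
      * apply Rplus_le_compat; apply Rmult_le_compat;
          try apply Cmod_ge_0; try lra.
        -- pose proof (Cmod_ge_0 (P s' x - sg)); pose proof (Cmod_ge_0 (P s' y - sg)); lra.
        -- pose proof (pow2_ge_0 (kap r m n)); lra.
        -- nra.
      * assert (t <= B * t) by nra; assert (B * t <= B * (B * t)) by nra; nra.
    + eapply Rle_trans; [exact H2|].
      assert (Cmod (P s' x - P s' y) * Cmod (D s' x) <= B * t * B)
        by (apply Rmult_le_compat; try apply Cmod_ge_0; lra).
      assert (Cmod (P s' y - sg) * Cmod (D s' x - D s' y) <= 2 * B * (B * t))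
        by (apply Rmult_le_compat; try apply Cmod_ge_0; lra).
      nra.
Qed.

(* The lattice parameter [N] of the outermost average is left free: it will be [m (S n)]. *)
Definition W (n N : nat) (x : pt) : C :=
  (RtoC (/ 2 ^ n) * avgC (fun s => D s x * Hav (delta r m n) N (P s x)) (Slist r m n))%C.

Lemma W_succ n N x :
  W (S n) N x = (RtoC (/ 2 ^ n) *
    avgC (fun s => avgC (fun sg =>
      RtoC (/ 2) * stepD (kap r m n) (c (S n)) (P s x - sg) (D s x)
      * Hav (stepd (kap r m n) (r (S n))) N (stepP (kap r m n) (Afun a (S n) x) (P s x - sg)))
      (Sigma r m n)) (Slist r m n))%C.
Proof.
  unfold W; simpl Slist; rewrite avgC_flat_map.
  replace (RtoC (/ 2 ^ S n)) with (RtoC (/ 2 ^ n) * RtoC (/ 2))%C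
    by (rewrite <- RtoC_mult; f_equal; simpl; field; apply pow_nonzero; lra).
  rewrite <- Cmult_assoc, <- avgC_mult; f_equal; apply avgC_ext; intros s Hs.
  rewrite <- avgC_mult; apply avgC_ext; intros sg _.
  unfold P, D; rewrite (Pfun_snoc _ _ _ n), (Dfun_snoc _ _ _ _ _ n) by auto.
  rewrite delta_stepd by apply hm; ring.
Qed.

(** At [N = m (S n)] the lattice hidden in [Hav] is [Sigma_(n+1)] itself, so the field of level n
    becomes a double average over the same pairs as in [W_succ], and the two can be compared term by
    term. *)
Lemma W_lattice n x :
  W n (m (S n)) x = (RtoC (/ 2 ^ n) *
    avgC (fun s => avgC (fun sg => D s x * ker (kap r m n) (P s x - sg)) (Sigma r m n)) (Slist r m n))%C.
Proof.
  unfold W; f_equal; apply avgC_ext; intros s _.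
  rewrite avgC_mult; reflexivity.
Qed.

Lemma Cmod_half_pow_le n z : Cmod (RtoC (/ 2 ^ n) * z) <= Cmod z.
Proof.
  assert (H : 1 <= 2 ^ n) by (apply pow_R1_Rle; lra).
  assert (0 < / 2 ^ n <= 1).
  { split; [apply Rinv_0_lt_compat; lra|]; rewrite <- Rinv_1; apply Rinv_le_contravar; lra. }
  rewrite Cmod_mult, Cmod_pos_RtoC by lra; pose proof (Cmod_ge_0 z); nra.
Qed.

(** [step_sup] bounds each term by a multiple of [k^2 / (|Z| + k)^3], which [avg_lat_inv3] averages
    to order [k^2 M / d^3 = 1 / (d M)]. The constant is [240000 * 576]. *)
Lemma W_sup n N x : (1 <= N)%nat -> Omega x ->
  Cmod (W (S n) N x - W n (m (S n)) x)
  <= 138240000 * Bn n / (r (S n) * delta r m n) / INR (m (S n)).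
Proof.
  intros HN Hx.
  pose proof (kap_bounds n) as Hk; pose proof (Bn_ge1 n) as HB; pose proof (delta_bounds n) as Hd.
  pose proof (hr_pos (S n) ltac:(lia)) as Hr; pose proof (hr_le (S n) ltac:(lia)) as Hr'.
  assert (HM : 0 < INR (m (S n))) by (apply lt_0_INR; pose proof (hm (S n)); lia).
  rewrite W_succ, W_lattice.
  match goal with |- Cmod (?x * ?y - ?x * ?z) <= _ =>
    replace (x * y - x * z)%C with (x * (y - z))%C by ring end.
  eapply Rle_trans; [apply Cmod_half_pow_le|].
  eapply Rle_trans; [apply Cmod_avgC_minus_le with
    (b := fun _ => 138240000 * Bn n / (r (S n) * delta r m n) / INR (m (S n)))|].
  - intros s Hs; destruct (tree_bounds n s Hs x Hx) as [HP HD].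
    eapply Rle_trans; [apply Cmod_avgC_minus_le with
      (b := fun sg => 240000 * Bn n * kap r m n ^ 2 / r (S n) * / (Cmod (P s x - sg) + kap r m n) ^ 3)|].
    + intros sg Hsg; apply Sigma_Cmod in Hsg.
      pose proof (Cmod_minus_le (P s x) sg).
      apply step_sup; auto; try lra.
      apply Afun_bound; [apply ha; lia | exact Hx].
    + rewrite avg_scal.
      pose proof (avg_lat_inv3 (delta r m n) (m (S n)) (P s x) ltac:(lra) (hm _)) as Hav3.
      rewrite <- Sigma_lat in Hav3; fold (kap r m n) in Hav3.
      eapply Rle_trans; [apply Rmult_le_compat_l; [|exact Hav3]|].
      * apply Rdiv_le_0_compat; [|lra]; pose proof (pow2_ge_0 (kap r m n)); nra.
      * right; unfold kap; field; lra.
  - apply avg_le_const; [|intros; lra].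
    apply Rdiv_le_0_compat; [|lra]; apply Rdiv_le_0_compat; nra.
Qed.

(** The range of [t] is the one where [B t <= k / 4], as [step_osc] requires. Apart from its factor
    [ln (1 + / t)], the cubic term averages to order [k t M / d^3 = t / d^2]; the quadratic one
    gives [t ln (1 + 3 M) / d^2]. *)
Lemma W_osc n N x y t : (1 <= N)%nat -> Omega x -> Omega y ->
  0 < t -> pdist x y <= t -> t <= delta r m n / (4 * Bn n * INR (m (S n))) ->
  Cmod (W (S n) N x - W (S n) N y)
  <= 30000000000 * Bn n ^ 2 / (delta r m n ^ 2 * r (S n) ^ 2) * (t * ln (1 + / t)).
Proof.
  intros HN Hx Hy Ht Hxy Htk.
  pose proof (kap_bounds n) as Hk; pose proof (Bn_ge1 n) as HB; pose proof (delta_bounds n) as Hd.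
  pose proof (hr_pos (S n) ltac:(lia)) as Hr; pose proof (hr_le (S n) ltac:(lia)) as Hr'.
  assert (HM : 1 <= INR (m (S n))) by (apply (le_INR 1), hm).
  set (B := Bn n) in *; set (M := INR (m (S n))) in *.
  assert (HBt : B * t <= kap r m n / 4).
  { apply Rmult_le_compat_l with (r := B) in Htk; [|lra].
    eapply Rle_trans; [exact Htk|]; right; unfold kap; fold M; field; lra. }
  (* Since [t] is below the mesh, the logarithm of [M] left by [avg_lat_inv2] is absorbed by
     [ln (1 + / t)]. *)
  assert (HMt : 3 * M <= / t).
  { apply Rmult_le_reg_r with t; [lra|]; rewrite Rinv_l by lra.
    apply Rle_trans with (3 * M * (delta r m n / (4 * B * M))); [apply Rmult_le_compat_l; lra|].
    replace (3 * M * (delta r m n / (4 * B * M))) with (3 * delta r m n / (4 * B)) by (field; lra).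
    apply le_Rdiv; nra. }
  assert (Hlt : ln (1 + 3 * M) <= ln (1 + / t)) by (apply ln_le; lra).
  assert (Hl0 : 0 <= ln (1 + 3 * M)) by (rewrite <- ln_1; apply ln_le; lra).
  rewrite !W_succ.
  match goal with |- Cmod (?x * ?y - ?x * ?z) <= _ =>
    replace (x * y - x * z)%C with (x * (y - z))%C by ring end.
  eapply Rle_trans; [apply Cmod_half_pow_le|].
  assert (HC : 0 <= B ^ 2 / (delta r m n ^ 2 * r (S n) ^ 2) * (t * ln (1 + / t))).
  { apply Rmult_le_pos; [|apply Rmult_le_pos; lra].
    apply Rdiv_le_0_compat; [apply pow2_ge_0|].
    apply Rmult_lt_0_compat; apply pow_lt; lra. }
  eapply Rle_trans; [apply Cmod_avgC_minus_le with (b := fun _ =>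
    30000000000 * B ^ 2 / (delta r m n ^ 2 * r (S n) ^ 2) * (t * ln (1 + / t)))|].
  - intros s Hs.
    destruct (tree_bounds n s Hs x Hx) as [HPx HDx]; destruct (tree_bounds n s Hs y Hy) as [HPy HDy].
    destruct (tree_lip n s Hs x y Hx Hy) as [HdP HdD]; fold B in HPx, HDx, HPy, HDy, HdP, HdD.
    assert (HBp : B * pdist x y <= B * t) by (apply Rmult_le_compat_l; lra).
    eapply Rle_trans; [apply Cmod_avgC_minus_le with (b := fun sg =>
      1350 * B ^ 2 * t * / (Cmod (P s x - sg) + kap r m n) ^ 2
      + 40000000 * B ^ 2 * kap r m n * t / r (S n) ^ 2 * ln (1 + / t)
        * / (Cmod (P s x - sg) + kap r m n) ^ 3)|].
    + intros sg Hsg; apply Sigma_Cmod in Hsg.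
      pose proof (Cmod_minus_le (P s x) sg); pose proof (Cmod_minus_le (P s y) sg).
      apply step_osc; auto; try lra.
      * apply Afun_bound; [apply ha; lia | exact Hx].
      * apply Afun_bound; [apply ha; lia | exact Hy].
      * replace (P s x - sg - (P s y - sg))%C with (P s x - P s y)%C by ring; lra.
      * pose proof (Afun_diff a (S n) x y); lra.
    + rewrite avg_plus, !avg_scal.
      pose proof (avg_lat_inv2 (delta r m n) (m (S n)) (P s x) ltac:(lra) (hm _)) as H2.
      pose proof (avg_lat_inv3 (delta r m n) (m (S n)) (P s x) ltac:(lra) (hm _)) as H3.
      rewrite <- Sigma_lat in H2, H3; fold (kap r m n) in H2, H3; fold M in H2, H3.
      assert (Hb1 : 0 <= 1350 * B ^ 2 * t) by (pose proof (pow2_ge_0 B); nra).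
      apply Rmult_le_compat_l with (r := 1350 * B ^ 2 * t) in H2; [|exact Hb1].
      assert (Hb2 : 0 <= 40000000 * B ^ 2 * kap r m n * t / r (S n) ^ 2 * ln (1 + / t)).
      { apply Rmult_le_pos; [|lra]; apply Rdiv_le_0_compat; [|apply pow_lt; lra].
        pose proof (pow2_ge_0 B); apply Rmult_le_pos; [apply Rmult_le_pos|]; lra. }
      apply Rmult_le_compat_l with (1 := Hb2) in H3.
      replace (40000000 * B ^ 2 * kap r m n * t / r (S n) ^ 2 * ln (1 + / t) * (576 * M / delta r m n ^ 3))
        with (23040000000 * (B ^ 2 / (delta r m n ^ 2 * r (S n) ^ 2) * (t * ln (1 + / t)))) in H3
        by (unfold kap; fold M; field; lra).
      replace (30000000000 * B ^ 2 / (delta r m n ^ 2 * r (S n) ^ 2) * (t * ln (1 + / t)))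
        with (30000000000 * (B ^ 2 / (delta r m n ^ 2 * r (S n) ^ 2) * (t * ln (1 + / t))))
        by (field; lra).
      assert (H4 : 1350 * B ^ 2 * t * (576 / delta r m n ^ 2 * ln (1 + 3 * M))
        <= 777600 * (B ^ 2 / (delta r m n ^ 2 * r (S n) ^ 2) * (t * ln (1 + / t)))).
      { replace (1350 * B ^ 2 * t * (576 / delta r m n ^ 2 * ln (1 + 3 * M)))
          with (777600 * (r (S n) ^ 2 * (B ^ 2 / (delta r m n ^ 2 * r (S n) ^ 2) * (t * ln (1 + 3 * M)))))
          by (field; lra).
        apply Rmult_le_compat_l; [lra|].
        assert (Hr2 : 0 <= r (S n) ^ 2 <= 1) by (split; [apply pow2_ge_0|nra]).
        apply Rle_trans with (r (S n) ^ 2 * (B ^ 2 / (delta r m n ^ 2 * r (S n) ^ 2) * (t * ln (1 + / t)))).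
        - apply Rmult_le_compat_l; [lra|].
          apply Rmult_le_compat_l; [|apply Rmult_le_compat_l; lra].
          apply Rdiv_le_0_compat; [apply pow2_ge_0|].
          apply Rmult_lt_0_compat; apply pow_lt; lra.
        - rewrite <- (Rmult_1_l (B ^ 2 / (delta r m n ^ 2 * r (S n) ^ 2) * (t * ln (1 + / t)))) at 2.
          apply Rmult_le_compat_r; lra. }
      lra.
  - apply avg_le_const; [|intros; lra].
    eapply Rle_trans; [|right; symmetry; apply Rmult_assoc].
    unfold Rdiv in *; rewrite Rmult_assoc; lra.
Qed.

(** At the root [P = w], its derivative is the constant [d0], and [Hav_diff] with [d = 1 / 2]
    applies at every scale. *)
Lemma W_osc_0 N x y t : (1 <= N)%nat -> 0 < t -> pdist x y <= t ->
  Cmod (W 0 N x - W 0 N y) <= 60000 * (t * ln (1 + / t)).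
Proof.
  intros HN Ht Hxy; unfold W.
  assert (E : forall f : list Cx -> C, avgC f (Slist r m 0) = f []).
  { intros f; unfold avgC, avg, rsum; simpl.
    rewrite Rinv_1, !Rmult_1_l, !Rplus_0_r; now destruct (f []). }
  rewrite !E; unfold D, P, Dfun, Pfun; simpl Daux; simpl Paux; simpl delta; simpl pow.
  rewrite Rinv_1.
  replace (RtoC 1 * (d0 * Hav (1 / 2) N (snd x)) - RtoC 1 * (d0 * Hav (1 / 2) N (snd y)))%C
    with (d0 * (Hav (1 / 2) N (snd x) - Hav (1 / 2) N (snd y)))%C by ring.
  rewrite Cmod_mult.
  destruct (Cmod_le_pdist x y) as [_ Hs].
  pose proof (Hav_diff (1 / 2) N (snd x) (snd y) t ltac:(lra) HN Ht (Rle_trans _ _ _ Hs Hxy)) as H.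
  pose proof (Cmod_ge_0 (Hav (1 / 2) N (snd x) - Hav (1 / 2) N (snd y))) as H0.
  pose proof (Cmod_ge_0 d0).
  assert (Hi : 0 < / t) by now apply Rinv_0_lt_compat.
  assert (Hl : ln (1 + 3 * (1 / 2) / t) <= 2 * ln (1 + / t)).
  { rewrite <- ln_pow2 by lra; apply ln_le; [unfold Rdiv; nra|]; unfold Rdiv; nra. }
  replace (6912 * t / (1 / 2) ^ 2) with (27648 * t) in H by (field; lra).
  assert (27648 * t * ln (1 + 3 * (1 / 2) / t) <= 27648 * t * (2 * ln (1 + / t)))
    by (apply Rmult_le_compat_l; lra).
  assert (0 <= ln (1 + / t)) by (rewrite <- ln_1; apply ln_le; lra).
  assert (0 <= t * ln (1 + / t)) by (apply Rmult_le_pos; lra).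
  nra.
Qed.
End Fields.

(** * The smoothed potentials *)

Definition V (a : nat -> Cx) (r : nat -> R) (m : nat -> nat) (n N : nat) (p : pt) : R :=
  / 2 ^ n * avg (fun s => Lav (delta r m n) N (Pfun a r m s p)) (Slist r m n).

Definition is_Cderive (f : R -> C) (t : R) (d : C) : Prop :=
  is_derive (fun x => fst (f x)) t (fst d) /\ is_derive (fun x => snd (f x)) t (snd d).

Lemma is_Cderive_ext f g t d : (forall x, f x = g x) -> is_Cderive f t d -> is_Cderive g t d.
Proof.
  intros E [H1 H2]; split; [eapply is_derive_ext; [|exact H1] | eapply is_derive_ext; [|exact H2]];
    intros x; simpl; now rewrite E.
Qed.

Lemma is_Cderive_eq f t d d' : is_Cderive f t d -> d = d' -> is_Cderive f t d'.
Proof. now intros H <-. Qed.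

Lemma is_Cderive_const z t : is_Cderive (fun _ => z) t 0%C.
Proof. split; simpl; apply (@is_derive_const R_AbsRing R_NormedModule). Qed.

Lemma is_Cderive_minus f g t d e : is_Cderive f t d -> is_Cderive g t e ->
  is_Cderive (fun x => f x - g x)%C t (d - e)%C.
Proof.
  intros [H1 H2] [H3 H4]; split; simpl;
    apply (@is_derive_minus R_AbsRing R_NormedModule); assumption.
Qed.

Lemma is_Cderive_mult f g t d e : is_Cderive f t d -> is_Cderive g t e ->
  is_Cderive (fun x => f x * g x)%C t (d * g t + f t * e)%C.
Proof.
  intros [H1 H2] [H3 H4]; split; simpl.
  - evar_last.
    + apply (@is_derive_minus R_AbsRing R_NormedModule);
        apply (is_derive_mult (K := R_AbsRing)); [exact H1 | exact H3 | intros; apply Rmult_comm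
          | exact H2 | exact H4 | intros; apply Rmult_comm].
    + unfold minus, plus, opp, mult; simpl; ring.
  - evar_last.
    + apply (@is_derive_plus R_AbsRing R_NormedModule);
        apply (is_derive_mult (K := R_AbsRing)); [exact H1 | exact H4 | intros; apply Rmult_comm
          | exact H2 | exact H3 | intros; apply Rmult_comm].
    + unfold minus, plus, opp, mult; simpl; ring.
Qed.

Definition line (p h : pt) (t : R) : pt := padd p (Cscale t (fst h), Cscale t (snd h)).

(** With [cw], the partial derivatives of [A_n]. Together with the starting values [0] and [1] they
    make [Dfun] the derivative of [P_s] in [z] and in [w]. *)
Definition cz (n : nat) : C := 1%C.
Definition cw (n : nat) : C := if Nat.odd n then 0%C else RtoC (1 / 100).

Lemma affine_derive (b s t : R) : is_derive (fun x => b + x * s) t s.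
Proof. auto_derive; [trivial | ring]. Qed.

Lemma is_Cderive_coord_z p h t : is_Cderive (fun x => fst (line p h x)) t (fst h).
Proof. split; simpl; apply affine_derive. Qed.

Lemma is_Cderive_coord_w p h t : is_Cderive (fun x => snd (line p h x)) t (snd h).
Proof. split; simpl; apply affine_derive. Qed.

Lemma is_Cderive_A a n p h t :
  is_Cderive (fun x => Afun a n (line p h x)) t (cz n * fst h + cw n * snd h)%C.
Proof.
  unfold Afun, cz, cw; destruct (Nat.odd n).
  - eapply is_Cderive_eq; [apply is_Cderive_minus;
      [apply is_Cderive_coord_z | apply is_Cderive_const] | ring].
  - eapply is_Cderive_ext with (f := fun x =>
      (fst (line p h x) - RtoC (- (1 / 100)) * snd (line p h x) - a n)%C).
    + intros x; unfold Csub, Cadd, Cscale, Cminus, Cplus, Copp, Cmult, RtoC; simpl; f_equal; ring.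
    + eapply is_Cderive_eq; [apply is_Cderive_minus; [apply is_Cderive_minus;
        [apply is_Cderive_coord_z | apply is_Cderive_mult;
          [apply is_Cderive_const | apply is_Cderive_coord_w]] | apply is_Cderive_const]|].
      rewrite RtoC_opp; ring.
Qed.

Lemma is_Cderive_P a r m : (forall n, (1 <= m n)%nat) ->
  forall n s, In s (Slist r m n) -> forall p h t,
  is_Cderive (fun x => Pfun a r m s (line p h x)) t
    (Dfun cz 0 a r m s (line p h t) * fst h + Dfun cw 1 a r m s (line p h t) * snd h)%C.
Proof.
  intros hm n; induction n as [|n IH]; intros s Hs p h t; simpl in Hs.
  - destruct Hs as [<-|[]]; unfold Pfun, Dfun; simpl Paux; simpl Daux.
    eapply is_Cderive_eq; [apply is_Cderive_coord_w|].
    assert (E : forall u v : C, v = (0 * u + 1 * v)%C) by (intros; ring); apply E.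
  - apply in_flat_map in Hs; destruct Hs as [s' [Hs' H2]].
    apply in_map_iff in H2; destruct H2 as [sg [<- Hsg]].
    rewrite !(Dfun_snoc _ _ _ _ _ n) by auto.
    eapply is_Cderive_ext; [intros x; symmetry; apply (Pfun_snoc a r m n); auto|].
    unfold stepP, stepD.
    assert (HZ := is_Cderive_minus _ _ _ _ _ (IH s' Hs' p h t) (is_Cderive_const sg t)).
    eapply is_Cderive_eq; [apply is_Cderive_minus;
      [apply is_Cderive_mult; exact HZ
      | apply is_Cderive_mult; [apply is_Cderive_const | apply is_Cderive_A]]|].
    simpl; ring.
Qed.

Lemma is_derive_log k s f t d : 0 < k -> is_Cderive f t d ->
  is_derive (fun x => / 2 * ln (Cmod (f x - s) ^ 2 + k ^ 2)) t (fst (d * ker k (f t - s))%C).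
Proof.
  intros Hk [H1 H2].
  pose proof (ker_den_pos k (f t - s)%C Hk) as Hp.
  assert (E : forall x, Cmod (f x - s) ^ 2
    = (fst (f x) - fst s) ^ 2 + (snd (f x) - snd s) ^ 2).
  { intros x; rewrite Cmod2_alt; reflexivity. }
  eapply is_derive_ext with (f := fun x =>
    / 2 * ln ((fst (f x) - fst s) ^ 2 + (snd (f x) - snd s) ^ 2 + k ^ 2)).
  { intros x; now rewrite E. }
  unfold ker; rewrite E in *.
  set (q := (fst (f t) - fst s) ^ 2 + (snd (f t) - snd s) ^ 2 + k ^ 2) in *.
  evar_last.
  - apply (is_derive_comp (fun y => / 2 * ln y)
      (fun x => (fst (f x) - fst s) ^ 2 + (snd (f x) - snd s) ^ 2 + k ^ 2)).
    + auto_derive; [exact Hp | reflexivity].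
    + apply (@is_derive_plus R_AbsRing R_NormedModule);
        [|apply (@is_derive_const R_AbsRing R_NormedModule)].
      apply (@is_derive_plus R_AbsRing R_NormedModule).
      * apply (is_derive_comp (fun y => (y - fst s) ^ 2) (fun x => fst (f x))); [|exact H1].
        auto_derive; [trivial | reflexivity].
      * apply (is_derive_comp (fun y => (y - snd s) ^ 2) (fun x => snd (f x))); [|exact H2].
        auto_derive; [trivial | reflexivity].
  - fold q; unfold scal, plus, mult, zero, Cdiv, Cinv, Cconj, Cminus, Cplus, Copp, Cmult, RtoC; simpl.
    unfold mult; simpl; field; lra.
Qed.

Lemma is_derive_avg {T} (F : T -> R -> R) (d : T -> R) l t :
  (forall x, In x l -> is_derive (F x) t (d x)) ->
  is_derive (fun y => avg (fun x => F x y) l) t (avg d l).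
Proof.
  intros H; unfold avg; apply is_derive_scal.
  - induction l as [|x l IH].
    + unfold rsum; simpl; apply (@is_derive_const R_AbsRing R_NormedModule).
    + eapply is_derive_ext; [intros y; symmetry; apply rsum_cons|].
      rewrite rsum_cons; apply (@is_derive_plus R_AbsRing R_NormedModule).
      * apply H; now left.
      * apply IH; intros; apply H; now right.
Qed.

Lemma avgC_plus {T} (f g : T -> C) l :
  avgC (fun x => f x + g x)%C l = (avgC f l + avgC g l)%C.
Proof. unfold avgC, Cplus; simpl; f_equal; apply avg_plus. Qed.

(** The derivative along [h] is the real part of [W_z h_z + W_w h_w]: the fields are twice the
    complex derivatives of [V], and the real gradient consists of their conjugates. *)
Lemma is_derive_V a r m n N p h t : (forall n, (1 <= m n)%nat) -> (1 <= N)%nat -> 0 < delta r m n ->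
  is_derive (fun x => V a r m n N (line p h x)) t
    (fst (W a r m cz 0 n N (line p h t) * fst h + W a r m cw 1 n N (line p h t) * snd h)%C).
Proof.
  intros hm HN Hd; destruct (lat_step_pos _ N Hd HN) as [Hk _].
  evar_last.
  - unfold V; apply is_derive_scal.
    apply is_derive_avg; intros s Hs; unfold Lav; apply is_derive_avg; intros sg _.
    apply is_derive_log; [exact Hk | exact (is_Cderive_P a r m hm n s Hs p h t)].
  - unfold W.
    set (y := line p h t).
    transitivity (fst (RtoC (/ 2 ^ n) * avgC (fun s => avgC (fun sg =>
      (Dfun cz 0 a r m s y * fst h + Dfun cw 1 a r m s y * snd h)
      * ker (delta r m n / INR N) (Pfun a r m s y - sg)) (lat (delta r m n) N)) (Slist r m n))%C).
    + unfold avgC; simpl; ring.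
    + f_equal.
      rewrite <- !Cmult_assoc, <- Cmult_plus_distr_l; f_equal.
      rewrite (Cmult_comm _ (fst h)), (Cmult_comm _ (snd h)), <- !avgC_mult, <- avgC_plus.
      apply avgC_ext; intros s _; rewrite avgC_mult; unfold Hav; ring.
Qed.

Lemma mean_value_le (f df : R -> R) e :
  (forall t, 0 <= t <= 1 -> is_derive f t (df t)) ->
  (forall t, 0 <= t <= 1 -> Rabs (df t - df 0) <= e) ->
  Rabs (f 1 - f 0 - df 0) <= e.
Proof.
  intros Hd He.
  destruct (MVT_gen f 0 1 df) as [t [Ht E]].
  - intros x Hx; rewrite Rmin_left, Rmax_right in Hx by lra; apply Hd; lra.
  - intros x Hx; rewrite Rmin_left, Rmax_right in Hx by lra.
    apply continuity_pt_filterlim, (ex_derive_continuous f x); exists (df x); apply Hd; lra.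
  - rewrite Rmin_left, Rmax_right in Ht by lra.
    rewrite E; replace (df t * (1 - 0) - df 0) with (df t - df 0) by ring; now apply He.
Qed.

(** * Comparison of the smoothed potentials with [u_n] *)

Lemma Rabs_avg_diff_le {T} (f g : T -> R) e l : 0 <= e ->
  (forall x, In x l -> Rabs (f x - g x) <= e) -> Rabs (avg f l - avg g l) <= e.
Proof.
  intros He H; rewrite <- avg_minus.
  eapply Rle_trans; [apply Rabs_avg_le with (b := fun _ => e); exact H|].
  apply avg_le_const; [exact He | intros; lra].
Qed.

Lemma inv_pow2_pos n : 0 < / 2 ^ n.
Proof. apply Rinv_0_lt_compat, pow_lt; lra. Qed.

Lemma u_n_avg a r m n p : u_n a r m n p
  = / 2 ^ n * avg (fun s => ln (Rmax (Cmod (Pfun a r m s p)) (delta r m n))) (Slist r m n).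
Proof. unfold u_n, avg, rsum; rewrite Rinv_mult, Rmult_assoc; reflexivity. Qed.

Lemma V_u_n a r m n N p : 0 < delta r m n -> (1 <= N)%nat ->
  Rabs (V a r m n N p - u_n a r m n p) <= / 2 ^ n * 1800.
Proof.
  intros Hd HN; pose proof (inv_pow2_pos n).
  rewrite u_n_avg; unfold V; rewrite <- Rmult_minus_distr_l, Rabs_mult, (Rabs_pos_eq (/ 2 ^ n)) by lra.
  apply Rmult_le_compat_l; [lra|].
  apply Rabs_avg_diff_le; [lra|]; intros s _; now apply Lav_log.
Qed.

(** With [X] the truncated modulus, [(r / 8) (|Z|^2 + k^2) <= X <= |Z|^2 + k^2]. The lower bound
    comes from [|Z|^2 - k^2 / 2] when [|Z| >= k] and from the truncation [k^2 r / 4] otherwise; the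
    latter is the source of [|ln r|]. *)
Lemma step_log k r al Z : 0 < k -> 0 < r <= 1 / 10 -> Cmod al <= 1 ->
  Rabs (/ 2 * ln (Rmax (Cmod (stepP k al Z)) (stepd k r)) - / 2 * ln (Cmod Z ^ 2 + k ^ 2))
  <= / 2 * (3 + Rabs (ln r)).
Proof.
  intros Hk Hr Hal.
  pose proof (stepP_ge k al Z Hal) as H1; pose proof (stepP_le k al Z Hal) as H2.
  pose proof (ker_den_pos k Z Hk) as Hp; pose proof (pow_lt k 2 Hk) as Hk2.
  assert (Hd : 0 < stepd k r) by (unfold stepd; nra).
  set (X := Rmax (Cmod (stepP k al Z)) (stepd k r)).
  pose proof (Rmax_l (Cmod (stepP k al Z)) (stepd k r)) as HX1; fold X in HX1.
  pose proof (Rmax_r (Cmod (stepP k al Z)) (stepd k r)) as HX2; fold X in HX2.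
  pose proof (pow2_ge_0 (Cmod Z)) as HZ.
  assert (HXu : X <= Cmod Z ^ 2 + k ^ 2) by (apply Rmax_lub; unfold stepd in *; nra).
  assert (HXl : r / 8 * (Cmod Z ^ 2 + k ^ 2) <= X).
  { destruct (Rle_dec (k ^ 2) (Cmod Z ^ 2)).
    - eapply Rle_trans; [|exact HX1]; nra.
    - eapply Rle_trans; [|exact HX2]; unfold stepd; nra. }
  assert (L1 : ln X <= ln (Cmod Z ^ 2 + k ^ 2)) by (apply ln_le; lra).
  assert (L2 : ln (r / 8 * (Cmod Z ^ 2 + k ^ 2)) <= ln X)
    by (apply ln_le; [apply Rmult_lt_0_compat; lra | exact HXl]).
  rewrite ln_mult, ln_div in L2 by lra.
  assert (L3 : ln 8 <= 3).
  { replace 8 with (2 ^ 3) by ring; rewrite ln_pow by lra.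
    pose proof (ln_le_sub1 2 ltac:(lra)); simpl; lra. }
  pose proof (Rle_abs (- ln r)) as L4; rewrite Rabs_Ropp in L4; pose proof (Rabs_pos (ln r)).
  apply Rabs_le; lra.
Qed.

(** The square in [P_(n+1)] compensates the extra 1/2 in the weight, and at [N = m (S n)] the
    lattice of [V] is [Sigma_(n+1)]; [step_log] then compares the two double averages term by
    term. *)
Lemma u_n_V a r m n p : (forall n, (1 <= n)%nat -> Cmod (a n) < 1 / 4) ->
  0 < r (S n) <= 1 / 10 -> (forall n, (1 <= m n)%nat) -> 0 < kap r m n -> Omega p ->
  Rabs (u_n a r m (S n) p - V a r m n (m (S n)) p) <= / 2 ^ n * (3 + Rabs (ln (r (S n)))).
Proof.
  intros ha Hr hm Hk Hp; pose proof (inv_pow2_pos n) as Hpow.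
  rewrite u_n_avg; simpl Slist; rewrite avg_flat_map; unfold V.
  replace (/ 2 ^ S n) with (/ 2 ^ n * / 2) by (simpl; field; apply pow_nonzero; lra).
  rewrite Rmult_assoc, <- Rmult_minus_distr_l, Rabs_mult, (Rabs_pos_eq (/ 2 ^ n)) by lra.
  apply Rmult_le_compat_l; [lra|].
  rewrite <- avg_scal.
  pose proof (Rabs_pos (ln (r (S n)))) as Hln.
  apply Rabs_avg_diff_le; [lra|]; intros s Hs.
  rewrite <- avg_scal; unfold Lav; rewrite <- Sigma_lat.
  apply Rabs_avg_diff_le; [lra|]; intros sg _.
  rewrite (Pfun_snoc a r m n) by auto; rewrite delta_stepd by apply hm.
  eapply Rle_trans; [apply step_log; auto|].
  - apply Afun_bound; [apply ha; lia | exact Hp].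
  - lra.
Qed.

(** * Choice of the lattice parameters *)

Lemma ln_small t : 0 < t <= 1 / 3 -> 1 <= Rabs (ln t) /\ ln (1 + / t) <= 2 * Rabs (ln t).
Proof.
  intros Ht.
  assert (Hi : 3 <= / t) by (replace 3 with (/ (1 / 3)) by field; apply Rinv_le_contravar; lra).
  assert (L : 1 <= ln (/ t)).
  { apply Rle_trans with (ln (exp 1)); [rewrite ln_exp; lra|].
    apply ln_le; [apply exp_pos|]; pose proof exp_le_3; lra. }
  assert (E : Rabs (ln t) = ln (/ t)).
  { rewrite ln_Rinv in * by lra; rewrite Rabs_left1; lra. }
  rewrite E; split; [exact L|].
  rewrite <- ln_pow2 by lra; apply ln_le; nra.
Qed.

(** [t0] is the range of [W_osc] and [E] the bound of [W_sup]. Below [t0] the oscillation is at most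
    [psi t]; above, two sup errors cost at most [psi t / 2 ^ n] by monotonicity; [E <= / 2 ^ n]
    makes the fields Cauchy. Apart from [M], the data are [psi], [rho], [n], [r_(n+1)] and
    [delta_n], all known before [m_(n+1)]. *)
Definition good_lattice (psi : R -> R) (rho : R) (n : nat) (rn d : R) (M : nat) : Prop :=
  let t0 := d / (4 * Bn n * INR M) in
  let E := 138240000 * Bn n / (rn * d) / INR M in
  (1 <= M)%nat /\ 0 < t0 < rho /\
  (forall t, 0 < t <= t0 ->
     30000000000 * Bn n ^ 2 / (d ^ 2 * rn ^ 2) * (t * ln (1 + / t)) <= psi t) /\
  2 * E <= / 2 ^ n * psi t0 /\ E <= / 2 ^ n.

(* The sup bound [E] is a constant times the scale [t0], so both requirements on [psi] are asked at scales at most [t0]. *)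
Lemma good_lattice_exists psi rho n rn d :
  (forall M, exists e, 0 < e /\ forall t, 0 < t < e -> psi t / (t * Rabs (ln t)) > M) ->
  0 < rho -> 0 < rn -> 0 < d -> exists M, good_lattice psi rho n rn d M.
Proof.
  intros Hlim Hrho Hrn Hd.
  pose proof (Bn_ge1 n) as HB; pose proof (inv_pow2_pos n) as Hpow.
  set (B := Bn n) in *.
  set (K5 := 30000000000 * B ^ 2 / (d ^ 2 * rn ^ 2)).
  set (K6 := 138240000 * 4 * B ^ 2 / (rn * d ^ 2)).
  assert (HB2 : 0 < B ^ 2) by (apply pow_lt; lra).
  assert (Hd2 : 0 < d ^ 2) by (apply pow_lt; lra).
  assert (Hr2 : 0 < rn ^ 2) by (apply pow_lt; lra).
  assert (HK5 : 0 < K5) by (apply Rdiv_lt_0_compat; nra).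
  assert (HK6 : 0 < K6) by (apply Rdiv_lt_0_compat; nra).
  assert (H2n : 0 < 2 ^ n) by (apply pow_lt; lra).
  (* [2 K5] pays for the oscillation, as [ln (1 + / t) <= 2 |ln t|]; [2 K6 2 ^ n] pays for
     [2 E <= / 2 ^ n * psi t0] with [E = K6 t0]. *)
  destruct (Hlim (2 * K5 + 2 * K6 * 2 ^ n)) as [e [He Hpsi]].
  assert (HK62 : 0 < 2 * K6 * 2 ^ n) by (apply Rmult_lt_0_compat; lra).
  assert (Hbig : forall t, 0 < t < e -> t <= 1 / 3 ->
            (2 * K5 + 2 * K6 * 2 ^ n) * (t * Rabs (ln t)) <= psi t).
  { intros t Ht Ht3; specialize (Hpsi t Ht); destruct (ln_small t ltac:(lra)) as [Hl _].
    assert (Hp : 0 < t * Rabs (ln t)) by (apply Rmult_lt_0_compat; lra).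
    apply Rgt_lt, Rlt_le in Hpsi.
    apply Rmult_le_compat_r with (r := t * Rabs (ln t)) in Hpsi; [|lra].
    replace (psi t / (t * Rabs (ln t)) * (t * Rabs (ln t))) with (psi t) in Hpsi by (field; lra).
    exact Hpsi. }
  (* Upper limit for [t0]: [/ 2 ^ n / K6] yields [E <= / 2 ^ n], and 1/3 is the range of
     [ln_small]. *)
  set (x := Rmin (Rmin rho e) (Rmin (1 / 3) (/ 2 ^ n / K6))).
  assert (Hq : 0 < / 2 ^ n / K6) by (apply Rdiv_lt_0_compat; lra).
  assert (Hx : 0 < x) by (unfold x; repeat apply Rmin_glb_lt; lra).
  assert (Hxs : x <= rho /\ x <= e /\ x <= 1 / 3 /\ x <= / 2 ^ n / K6).
  { unfold x; repeat split.
    - eapply Rle_trans; [apply Rmin_l|apply Rmin_l].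
    - eapply Rle_trans; [apply Rmin_l|apply Rmin_r].
    - eapply Rle_trans; [apply Rmin_r|apply Rmin_l].
    - eapply Rle_trans; [apply Rmin_r|apply Rmin_r]. }
  destruct (INR_unbounded (d / (4 * B * x))) as [M HM].
  assert (HMp : 0 < INR M).
  { assert (0 < d / (4 * B * x)) by (apply Rdiv_lt_0_compat; nra); lra. }
  assert (Ht0 : 0 < d / (4 * B * INR M)) by (apply Rdiv_lt_0_compat; nra).
  assert (Ht0x : d / (4 * B * INR M) < x).
  { apply Rmult_lt_reg_r with (4 * B * INR M); [nra|].
    replace (d / (4 * B * INR M) * (4 * B * INR M)) with d by (field; lra).
    apply Rmult_lt_compat_r with (r := 4 * B * x) in HM; [|nra].
    replace (d / (4 * B * x) * (4 * B * x)) with d in HM by (field; lra); nra. }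
  assert (HE : 138240000 * B / (rn * d) / INR M = K6 * (d / (4 * B * INR M)))
    by (unfold K6; field; lra).
  exists M; unfold good_lattice; fold B; cbv zeta; rewrite HE; fold K5.
  set (t0 := d / (4 * B * INR M)) in *.
  split; [|split; [lra|split; [|split]]].
  - destruct M; [simpl in HMp; lra | lia].
  - intros t Ht; eapply Rle_trans; [|apply (Hbig t); lra].
    destruct (ln_small t ltac:(lra)) as [L1 L2].
    assert (HtL : 0 < t * Rabs (ln t)) by (apply Rmult_lt_0_compat; lra).
    assert (t * ln (1 + / t) <= t * (2 * Rabs (ln t))) by (apply Rmult_le_compat_l; lra).
    apply Rle_trans with (K5 * (t * (2 * Rabs (ln t)))); [apply Rmult_le_compat_l; lra|].
    nra.
  - destruct (ln_small t0 ltac:(lra)) as [L1 _].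
    apply Rle_trans with (/ 2 ^ n * ((2 * K5 + 2 * K6 * 2 ^ n) * (t0 * Rabs (ln t0)))).
    + apply Rle_trans with (/ 2 ^ n * ((2 * K6 * 2 ^ n) * (t0 * 1))); [right; field; lra|].
      apply Rmult_le_compat_l; [lra|].
      apply Rmult_le_compat; [lra | lra | lra | apply Rmult_le_compat_l; lra].
    + apply Rmult_le_compat_l; [lra|]; apply Hbig; lra.
  - apply Rle_trans with (K6 * (/ 2 ^ n / K6)); [apply Rmult_le_compat_l; lra|].
    right; field; lra.
Qed.

(** [m_(n+1)] depends on [delta_n], which depends on the earlier [m]. The recursion is therefore on
    [delta], from which [mseq] reads off the parameters through a choice function [Mf]. *)
Fixpoint dseq (r : nat -> R) (Mf : nat -> R -> nat) (n : nat) : R :=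
  match n with
  | O => 1 / 2
  | S k => dseq r Mf k ^ 2 * r (S k) / (4 * INR (Mf k (dseq r Mf k)) ^ 2)
  end.

Definition mseq (r : nat -> R) (Mf : nat -> R -> nat) (n : nat) : nat :=
  match n with O => 1%nat | S k => Mf k (dseq r Mf k) end.

Lemma delta_dseq r Mf n : delta r (mseq r Mf) n = dseq r Mf n.
Proof. induction n as [|n IH]; [reflexivity|]; simpl; now rewrite IH. Qed.

Lemma good_sequence_exists psi rho r :
  (forall M, exists e, 0 < e /\ forall t, 0 < t < e -> psi t / (t * Rabs (ln t)) > M) ->
  0 < rho -> (forall n, (1 <= n)%nat -> 0 < r n) ->
  exists m : nat -> nat, (forall n, (1 <= m n)%nat) /\
    forall n, good_lattice psi rho n (r (S n)) (delta r m n) (m (S n)).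
Proof.
  intros Hlim Hrho Hr.
  destruct (functional_choice
    (fun (q : nat * R) M => 0 < snd q -> good_lattice psi rho (fst q) (r (S (fst q))) (snd q) M))
    as [f Hf].
  { intros [n d]; simpl; destruct (Rlt_dec 0 d) as [Hd|Hd].
    - destruct (good_lattice_exists psi rho n (r (S n)) d Hlim Hrho (Hr (S n) ltac:(lia)) Hd) as [M HM].
      now exists M.
    (* A dummy value for nonpositive [d], which [dseq] never takes. *)
    - exists 1%nat; intros; lra. }
  set (Mf := fun n d => f (n, d)).
  assert (Hd : forall n, 0 < dseq r Mf n).
  { induction n as [|n IH]; simpl; [lra|].
    destruct (Hf (n, dseq r Mf n) IH) as [HM _].
    assert (0 < INR (Mf n (dseq r Mf n))) by (apply lt_0_INR; exact HM).
    apply Rdiv_lt_0_compat.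
    - apply Rmult_lt_0_compat; [apply (pow_lt _ 2 IH) | apply Hr; lia].
    - pose proof (pow_lt _ 2 H); simpl in *; lra. }
  exists (mseq r Mf); split.
  - intros [|n]; simpl; [lia|]; exact (proj1 (Hf (n, dseq r Mf n) (Hd n))).
  - intros n; rewrite delta_dseq; exact (Hf (n, dseq r Mf n) (Hd n)).
Qed.

(** * Limits of sequences and openness of the domain *)

Lemma pdist_eq0 x y : pdist x y = 0 -> x = y.
Proof.
  intros H; destruct (Cmod_le_pdist x y) as [H1 H2]; rewrite H in H1, H2.
  assert (E : forall u v : C, Cmod (u - v) <= 0 -> u = v).
  { intros u v Huv; pose proof (Cmod_ge_0 (u - v)).
    replace u with ((u - v) + v)%C by ring; rewrite (Cmod_eq_0 (u - v)) by lra; ring. }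
  destruct x, y; simpl in *; f_equal; now apply E.
Qed.

(** Naming the limit by [Lim_seq] lets the limit functions be defined at every point, with
    convergence proved only on [Omega]. *)
Lemma ex_lim_of_summable (x b : nat -> R) :
  (forall n, Rabs (x (S n) - x n) <= b n) -> ex_series b ->
  is_lim_seq x (real (Lim_seq x)).
Proof.
  intros H Hb.
  destruct (ex_series_le (fun n => x (S n) - x n) b H Hb) as [l Hl].
  assert (Hlim : is_lim_seq x (l + x 0%nat)).
  { apply is_lim_seq_incr_1.
    eapply is_lim_seq_ext; [|apply (is_lim_seq_plus' _ _ l (x 0%nat) Hl (is_lim_seq_const (x 0%nat)))].
    intros n; simpl; induction n as [|n IH].
    - rewrite sum_O; lra.
    - rewrite sum_Sn; unfold plus; simpl; lra. }
  now rewrite (is_lim_seq_unique _ _ Hlim).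
Qed.

Lemma is_lim_seq_abs_le (x : nat -> R) (l b : R) :
  is_lim_seq x l -> (forall n, Rabs (x n) <= b) -> Rabs l <= b.
Proof.
  intros Hx Hb.
  exact (is_lim_seq_le (fun n => Rabs (x n)) (fun _ => b) (Rabs l) b Hb
           (is_lim_seq_abs _ _ Hx) (is_lim_seq_const b)).
Qed.

Lemma ex_series_half : ex_series (fun n => / 2 ^ n).
Proof.
  eapply ex_series_ext; [|apply (ex_series_geom (/ 2)); rewrite Rabs_pos_eq; lra].
  intros n; simpl; apply pow_inv.
Qed.

Lemma Cmod_le_abs (z : C) : Cmod z <= Rabs (fst z) + Rabs (snd z).
Proof.
  pose proof (Rabs_pos (fst z)); pose proof (Rabs_pos (snd z)).
  unfold Cmod; rewrite <- (sqrt_pow2 (Rabs (fst z) + Rabs (snd z))) by lra.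
  apply sqrt_le_1_alt; rewrite <- (pow2_abs (fst z)), <- (pow2_abs (snd z)); nra.
Qed.

Lemma abs_le_Cmod_minus (z w : C) :
  Rabs (fst z - fst w) <= Cmod (z - w) /\ Rabs (snd z - snd w) <= Cmod (z - w).
Proof.
  pose proof (Rmax_Cmod (z - w)%C); split; eapply Rle_trans; [apply Rmax_l | eassumption | apply Rmax_r | eassumption].
Qed.

Lemma Omega_open p : Omega p ->
  exists e, 0 < e /\ forall q, pdist q p < e -> Omega q.
Proof.
  intros [H1 H2]; change Defs.Cmod with Cmod in *.
  exists (Rmin (1 / 2 - Cmod (fst p)) (1 - Cmod (snd p))); split.
  - apply Rmin_glb_lt; lra.
  - intros q Hq; destruct (Cmod_le_pdist q p) as [D1 D2].
    pose proof (Rmin_l (1 / 2 - Cmod (fst p)) (1 - Cmod (snd p))).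
    pose proof (Rmin_r (1 / 2 - Cmod (fst p)) (1 - Cmod (snd p))).
    pose proof (Cmod_minus_ge (fst q) (fst p)); pose proof (Cmod_minus_ge (snd q) (snd p)).
    split; change Defs.Cmod with Cmod; lra.
Qed.

(** * Uniform modulus of continuity and passage to the limit *)

Section Limit.
Variables (a : nat -> Cx) (r : nat -> R) (m : nat -> nat) (psi : R -> R) (rho : R).
Hypothesis ha : forall n, (1 <= n)%nat -> Cmod (a n) < 1 / 4.
Hypothesis hr_pos : forall n, (1 <= n)%nat -> 0 < r n.
Hypothesis hr_le : forall n, (1 <= n)%nat -> r n <= 1 / 10.
Hypothesis hm : forall n, (1 <= m n)%nat.
Hypothesis hgood : forall n, good_lattice psi rho n (r (S n)) (delta r m n) (m (S n)).
Hypothesis hrho : 0 < rho <= 1 / 3.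
Hypothesis psi0 : psi 0 = 0.
Hypothesis psi_mono : forall x y, 0 <= x -> x <= y -> y < rho -> psi x <= psi y.
Hypothesis psi_ge : forall t, 0 < t < rho -> t * Rabs (ln t) <= psi t.

Lemma psi_ge0 t : 0 <= t < rho -> 0 <= psi t.
Proof. intros H; rewrite <- psi0; apply psi_mono; lra. Qed.

Lemma W_cauchy c d0 n x : (forall n, Cmod (c n) <= 1) -> Cmod d0 <= 1 -> Omega x ->
  Cmod (W a r m c d0 (S n) (m (S (S n))) x - W a r m c d0 n (m (S n)) x) <= / 2 ^ n.
Proof.
  intros Hc Hd0 Hx; destruct (hgood n) as (_ & _ & _ & _ & HE).
  eapply Rle_trans; [apply W_sup; auto | exact HE].
Qed.

(** The induction carries all [N] at once: the step uses [W_n] at [N = m (S n)] but must conclude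
    for an arbitrary next parameter. The constant [120002 - 2 / 2 ^ n] starts at [60000 * 2] and
    grows by [/ 2 ^ n], the cost of the two sup errors at scales above [t0]; below [t0], [W_osc]
    gives the constant 1 without the induction hypothesis. *)
Lemma W_psi c d0 n : (forall n, Cmod (c n) <= 1) -> Cmod d0 <= 1 ->
  forall N x y, (1 <= N)%nat -> Omega x -> Omega y -> pdist x y < rho ->
  Cmod (W a r m c d0 n N x - W a r m c d0 n N y) <= (120002 - 2 * / 2 ^ n) * psi (pdist x y).
Proof.
  intros Hc Hd0; induction n as [|n IH]; intros N x y HN Hx Hy Hxy;
    (* The case [x = y] is set apart, the estimates at scale [t] being for [0 < t]. *)
    (destruct (pdist_ge0 x y) as [Ht|Ht];
     [| symmetry in Ht; rewrite Ht, psi0, (pdist_eq0 x y Ht), Rmult_0_r;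
        match goal with |- Cmod (?z - ?z) <= _ => replace (z - z)%C with (RtoC 0) by ring end;
        rewrite Cmod_0; lra]); set (t := pdist x y) in *.
  - eapply Rle_trans; [apply (W_osc_0 a r m c d0 Hd0 N x y t HN Ht (Rle_refl _))|].
    destruct (ln_small t ltac:(lra)) as [_ L].
    pose proof (psi_ge t ltac:(lra)).
    assert (t * ln (1 + / t) <= t * (2 * Rabs (ln t))) by (apply Rmult_le_compat_l; lra).
    simpl; rewrite Rinv_1; lra.
  - destruct (hgood n) as (HM & Ht0 & Hosc & HE & _).
    set (t0 := delta r m n / (4 * Bn n * INR (m (S n)))) in *.
    pose proof (inv_pow2_pos n) as Hp.
    assert (Hp1 : / 2 ^ n <= 1).
    { rewrite <- Rinv_1; apply Rinv_le_contravar; [lra|apply pow_R1_Rle; lra]. }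
    assert (Hhalf : / 2 ^ S n = / 2 ^ n / 2) by (simpl; field; apply pow_nonzero; lra).
    pose proof (psi_ge0 t ltac:(lra)) as Hpsi.
    destruct (Rle_dec t t0) as [Hle|Hgt].
    + eapply Rle_trans; [apply (W_osc a r m c d0 ha hr_pos hr_le hm Hc Hd0 n N x y t); auto; apply Rle_refl|].
      eapply Rle_trans; [apply Hosc; lra|]; rewrite Hhalf; nra.
    + pose proof (W_sup a r m c d0 ha hr_pos hr_le hm Hc Hd0 n N x HN Hx) as S1.
      pose proof (W_sup a r m c d0 ha hr_pos hr_le hm Hc Hd0 n N y HN Hy) as S2.
      pose proof (IH (m (S n)) x y (hm _) Hx Hy Hxy) as S3; fold t in S3.
      assert (S4 : / 2 ^ n * psi t0 <= / 2 ^ n * psi t)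
        by (apply Rmult_le_compat_l; [lra|]; apply psi_mono; lra).
      set (wx := W a r m c d0 (S n) N x) in *; set (wy := W a r m c d0 (S n) N y) in *.
      set (vx := W a r m c d0 n (m (S n)) x) in *; set (vy := W a r m c d0 n (m (S n)) y) in *.
      replace (wx - wy)%C with ((wx - vx) + (vx - vy) - (wy - vy))%C by ring.
      pose proof (Cmod_minus_le ((wx - vx) + (vx - vy)) (wy - vy)).
      pose proof (Cmod_triangle (wx - vx) (vx - vy)).
      rewrite Hhalf; lra.
Qed.

Lemma pdist_line p h t : 0 <= t <= 1 -> pdist (line p h t) p <= pnorm h.
Proof.
  intros Ht; unfold pdist, pnorm; simpl fst; simpl snd.
  assert (E : forall u v : C, Cmod (Csub (Cadd u (Cscale t v)) u) = t * Cmod v).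
  { intros u v; rewrite <- (Cmod_pos_RtoC t) at 2 by lra; rewrite <- Cmod_mult; f_equal.
    unfold Csub, Cadd, Cscale, Cmult, RtoC; simpl; f_equal; ring. }
  change Defs.Cmod with Cmod; rewrite !E; apply sqrt_le_1_alt.
  assert (E2 : forall v, t ^ 2 * v ^ 2 <= v ^ 2).
  { intros v; pose proof (pow2_ge_0 v); assert (0 <= t ^ 2 <= 1) by nra; nra. }
  rewrite !Rpow_mult_distr; apply Rplus_le_compat; apply E2.
Qed.

(** Mean value theorem along the segment, on which each of the two fields stays within
    [120002 psi(|h|)] of its value at [p]. The bound is free of [n], so it survives in the limit and
    gives differentiability there. *)
Lemma V_taylor n p h : (forall q, pdist q p <= pnorm h -> Omega q) -> pnorm h < rho ->
  Rabs (V a r m n (m (S n)) (padd p h) - V a r m n (m (S n)) p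
        - fst (W a r m cz 0 n (m (S n)) p * fst h + W a r m cw 1 n (m (S n)) p * snd h)%C)
  <= 240004 * psi (pnorm h) * pnorm h.
Proof.
  intros HO Hh.
  assert (E0 : line p h 0 = p).
  { destruct p as [[] []], h as [[] []]; unfold line, padd, Cadd, Cscale; simpl.
    repeat f_equal; ring. }
  assert (E1 : line p h 1 = padd p h).
  { destruct p as [[] []], h as [[] []]; unfold line, padd, Cadd, Cscale; simpl.
    repeat f_equal; ring. }
  assert (Hcz : forall k, Cmod (cz k) <= 1) by (intros; unfold cz; rewrite Cmod_1; lra).
  assert (Hcw : forall k, Cmod (cw k) <= 1).
  { intros k; unfold cw; destruct (Nat.odd k); [rewrite Cmod_0|rewrite Cmod_pos_RtoC]; lra. }
  assert (H00 : Cmod 0 <= 1) by (rewrite Cmod_0; lra).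
  assert (H11 : Cmod 1 <= 1) by (rewrite Cmod_1; lra).
  pose proof (delta_bounds r m hr_pos hr_le hm n) as Hd.
  pose proof (mean_value_le (fun t => V a r m n (m (S n)) (line p h t))
    (fun t => fst (W a r m cz 0 n (m (S n)) (line p h t) * fst h
                 + W a r m cw 1 n (m (S n)) (line p h t) * snd h)%C)
    (240004 * psi (pnorm h) * pnorm h)) as HMV.
  cbv beta in HMV; rewrite E0, E1 in HMV; apply HMV; clear HMV.
  - intros t _; apply is_derive_V; [exact hm | apply hm | lra].
  - intros t Ht; pose proof (pdist_line p h t Ht) as Hl.
    pose proof (pdist_ge0 (line p h t) p) as Hl0.
    assert (Hp : Omega p).
    { apply HO; replace (pdist p p) with 0; [apply sqrt_pos|].
      unfold pdist, pnorm, Csub, Defs.Cmod; simpl; rewrite !Rminus_diag.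
      replace (sqrt (0 * (0 * 1) + 0 * (0 * 1))) with 0
        by (symmetry; replace (0 * (0 * 1) + 0 * (0 * 1)) with 0 by ring; apply sqrt_0).
      replace (0 * (0 * 1) + 0 * (0 * 1)) with 0 by ring; now rewrite sqrt_0. }
    pose proof (HO _ Hl) as Hq.
    pose proof (W_psi cz 0 n Hcz H00 (m (S n)) _ _ (hm _) Hq Hp ltac:(lra)) as B1.
    pose proof (W_psi cw 1 n Hcw H11 (m (S n)) _ _ (hm _) Hq Hp ltac:(lra)) as B2.
    pose proof (psi_mono _ _ Hl0 Hl Hh) as Hm.
    pose proof (psi_ge0 (pdist (line p h t) p) ltac:(lra)) as Hm0.
    pose proof (inv_pow2_pos n) as Hpow.
    set (w1 := W a r m cz 0 n (m (S n)) (line p h t)) in *; set (v1 := W a r m cz 0 n (m (S n)) p) in *.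
    set (w2 := W a r m cw 1 n (m (S n)) (line p h t)) in *; set (v2 := W a r m cw 1 n (m (S n)) p) in *.
    replace (fst (w1 * fst h + w2 * snd h)%C - fst (v1 * fst h + v2 * snd h)%C)
      with (fst ((w1 - v1) * fst h + (w2 - v2) * snd h)%C)
      by (unfold Cminus, Cmult, Cplus, Copp; simpl; ring).
    eapply Rle_trans; [apply re_le_Cmod|].
    eapply Rle_trans; [apply Cmod_triangle|]; rewrite !Cmod_mult.
    assert (N1 : Cmod (fst h) <= pnorm h /\ Cmod (snd h) <= pnorm h).
    { unfold pnorm; change Defs.Cmod with Cmod.
      pose proof (Cmod_ge_0 (fst h)); pose proof (Cmod_ge_0 (snd h)).
      split; [rewrite <- (sqrt_pow2 (Cmod (fst h))) at 1 by lra
             | rewrite <- (sqrt_pow2 (Cmod (snd h))) at 1 by lra];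
        apply sqrt_le_1_alt; nra. }
    destruct N1 as [N1 N2].
    assert (B1' : Cmod (w1 - v1) <= 120002 * psi (pnorm h)) by nra.
    assert (B2' : Cmod (w2 - v2) <= 120002 * psi (pnorm h)) by nra.
    apply Rle_trans with (120002 * psi (pnorm h) * pnorm h + 120002 * psi (pnorm h) * pnorm h);
      [|lra].
    apply Rplus_le_compat; apply Rmult_le_compat; try apply Cmod_ge_0; assumption.
Qed.

(** Real and imaginary parts pass to the limit separately, which doubles the constant 120002 of
    [W_psi]. *)
Lemma W_lim c d0 : (forall n, Cmod (c n) <= 1) -> Cmod d0 <= 1 ->
  exists w : pt -> C,
    (forall x, Omega x ->
       is_lim_seq (fun n => fst (W a r m c d0 n (m (S n)) x)) (fst (w x)) /\
       is_lim_seq (fun n => snd (W a r m c d0 n (m (S n)) x)) (snd (w x))) /\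
    (forall x y, Omega x -> Omega y -> pdist x y < rho ->
       Cmod (w x - w y) <= 240004 * psi (pdist x y)).
Proof.
  intros Hc Hd0.
  set (w := fun x => (real (Lim_seq (fun n => fst (W a r m c d0 n (m (S n)) x))),
                      real (Lim_seq (fun n => snd (W a r m c d0 n (m (S n)) x)))) : C).
  assert (Hw : forall x, Omega x ->
       is_lim_seq (fun n => fst (W a r m c d0 n (m (S n)) x)) (fst (w x)) /\
       is_lim_seq (fun n => snd (W a r m c d0 n (m (S n)) x)) (snd (w x))).
  { intros x Hx.
    assert (HC := fun n => W_cauchy c d0 n x Hc Hd0 Hx).
    split; apply (ex_lim_of_summable _ (fun n => / 2 ^ n)); try apply ex_series_half;
      intros n; eapply Rle_trans; [| exact (HC n) | | exact (HC n)].
    - apply (proj1 (abs_le_Cmod_minus _ _)).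
    - apply (proj2 (abs_le_Cmod_minus _ _)). }
  exists w; split; [exact Hw|].
  intros x y Hx Hy Hxy.
  destruct (Hw x Hx) as [X1 X2], (Hw y Hy) as [Y1 Y2].
  assert (HB : forall n, Cmod (W a r m c d0 n (m (S n)) x - W a r m c d0 n (m (S n)) y)
                         <= 120002 * psi (pdist x y)).
  { intros n; eapply Rle_trans; [apply W_psi; auto|].
    pose proof (psi_ge0 (pdist x y) (conj (pdist_ge0 x y) Hxy)).
    pose proof (inv_pow2_pos n); nra. }
  eapply Rle_trans; [apply Cmod_le_abs|].
  assert (L1 : Rabs (fst (w x) - fst (w y)) <= 120002 * psi (pdist x y)).
  { apply (is_lim_seq_abs_le _ _ _ (is_lim_seq_minus' _ _ _ _ X1 Y1)).
    intros n; eapply Rle_trans; [apply (proj1 (abs_le_Cmod_minus _ _)) | apply HB]. }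
  assert (L2 : Rabs (snd (w x) - snd (w y)) <= 120002 * psi (pdist x y)).
  { apply (is_lim_seq_abs_le _ _ _ (is_lim_seq_minus' _ _ _ _ X2 Y2)).
    intros n; eapply Rle_trans; [apply (proj2 (abs_le_Cmod_minus _ _)) | apply HB]. }
  change (Rabs (fst (w x) - fst (w y)) + Rabs (snd (w x) - snd (w y)) <= 240004 * psi (pdist x y)).
  lra.
Qed.

Lemma u_n_lim p :
  (exists l, Un_cv (fun N => sum_f_R0 (fun k => Rabs (ln (r (S k))) / 2 ^ (S k)) N) l) ->
  Omega p ->
  is_lim_seq (fun n => u_n a r m n p) (real (Lim_seq (fun n => u_n a r m n p))).
Proof.
  intros [l Hl] Hp.
  (* 1800 comes from [V_u_n] and 3 from [u_n_V]; the factor 2 rewrites [/ 2 ^ n] with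
     [2 ^ (S n)]. *)
  apply (ex_lim_of_summable _
    (fun n => 1803 * / 2 ^ n + 2 * (Rabs (ln (r (S n))) / 2 ^ (S n)))).
  - intros n.
    pose proof (delta_bounds r m hr_pos hr_le hm n) as Hd.
    pose proof (kap_bounds r m hr_pos hr_le hm n) as Hk.
    pose proof (V_u_n a r m n (m (S n)) p ltac:(lra) (hm _)) as H1.
    pose proof (u_n_V a r m n p ha (conj (hr_pos (S n) ltac:(lia)) (hr_le (S n) ltac:(lia)))
                  hm ltac:(lra) Hp) as H2.
    replace (u_n a r m (S n) p - u_n a r m n p)
      with ((u_n a r m (S n) p - V a r m n (m (S n)) p) + (V a r m n (m (S n)) p - u_n a r m n p)) by ring.
    eapply Rle_trans; [apply Rabs_triang|].
    replace (2 * (Rabs (ln (r (S n))) / 2 ^ S n)) with (/ 2 ^ n * Rabs (ln (r (S n))))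
      by (simpl; field; apply pow_nonzero; lra).
    lra.
  - apply (ex_series_plus (V := R_NormedModule)).
    + exact (ex_series_scal (V := R_NormedModule) 1803 _ ex_series_half).
    + apply (ex_series_scal (V := R_NormedModule) 2 (fun n => Rabs (ln (r (S n))) / 2 ^ S n)).
      exists l; now apply is_series_Reals.
Qed.
End Limit.

Import Defs.

Theorem theorem3
  (a : nat -> Cx) (r : nat -> R) (psi : R -> R)
  (ha_disk : forall n, (1 <= n)%nat -> Cmod (a n) < 1/4)
  (ha_even : forall c, Cmod c < 1/4 -> forall e, 0 < e ->
       exists p, (1 <= p)%nat /\ Cmod (Csub (a (2 * p)%nat) c) < e)
  (ha_odd : forall c, Cmod c < 1/4 -> forall e, 0 < e ->
       exists p, Cmod (Csub (a (2 * p + 1)%nat) c) < e)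
  (hr_pos : forall n, (1 <= n)%nat -> 0 < r n)
  (hr_le : forall n, (1 <= n)%nat -> r n <= 1/10)
  (hr_dec : forall n, (1 <= n)%nat -> r (S n) <= r n)
  (hr_lim : Un_cv (fun n => r (S n)) 0)
  (hr_sum : exists l, Un_cv
       (fun N => sum_f_R0 (fun k => Rabs (ln (r (S k))) / 2 ^ (S k)) N) l)
  (hpsi : gauge psi)
  (hpsi_lim : forall M, exists d, 0 < d /\
       forall t, 0 < t < d -> psi t / (t * Rabs (ln t)) > M) :
  exists m : nat -> nat,
    (forall n, (1 <= m n)%nat) /\
    exists u : pt -> R,
      (forall p, Omega p -> Un_cv (fun n => u_n a r m n p) (u p)) /\
      locally_C1psi psi Omega u.
Proof.
  destruct hpsi as (rho1 & Hrho1 & Hpsi0 & Hmono & Hcont).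
  destruct (hpsi_lim 1) as (d1 & Hd1 & Hge).
  (* [rho1] is the range where [psi] is monotone, [d1] the one where [t |ln t| <= psi t], and 1/3
     that of [ln_small]. *)
  set (rho := Rmin rho1 (Rmin d1 (1 / 3))).
  assert (Hrho : 0 < rho /\ rho <= rho1 /\ rho <= d1 /\ rho <= 1 / 3).
  { unfold rho; repeat split.
    - repeat apply Rmin_glb_lt; lra.
    - apply Rmin_l.
    - eapply Rle_trans; [apply Rmin_r | apply Rmin_l].
    - eapply Rle_trans; [apply Rmin_r | apply Rmin_r]. }
  destruct Hrho as (Hr0 & Hr1 & Hr2 & Hr3).
  assert (Hpm : forall x y, 0 <= x -> x <= y -> y < rho -> psi x <= psi y)
    by (intros; apply Hmono; lra).
  assert (Hpge : forall t, 0 < t < rho -> t * Rabs (ln t) <= psi t).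
  { intros t Ht; specialize (Hge t ltac:(lra)).
    destruct (ln_small t ltac:(lra)) as [Hl _].
    assert (Hp : 0 < t * Rabs (ln t)) by (apply Rmult_lt_0_compat; lra).
    apply Rgt_lt, Rlt_le in Hge.
    apply Rmult_le_compat_r with (r := t * Rabs (ln t)) in Hge; [|lra].
    replace (psi t / (t * Rabs (ln t)) * (t * Rabs (ln t))) with (psi t) in Hge by (field; lra).
    lra. }
  destruct (good_sequence_exists psi rho r hpsi_lim Hr0 hr_pos) as (m & Hm & Hgood).
  exists m; split; [exact Hm|].
  set (u := fun p => real (Lim_seq (fun n => u_n a r m n p))).
  assert (Hu : forall p, Omega p -> is_lim_seq (fun n => u_n a r m n p) (u p))
    by (intros p Hp; apply u_n_lim; assumption).
  (* [V_n] stays within [1800 / 2 ^ n] of [u_n], so [u] is also the limit of functions that can be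
     differentiated. *)
  assert (HV : forall p, Omega p -> is_lim_seq (fun n => V a r m n (m (S n)) p) (u p)).
  { intros p Hp.
    apply is_lim_seq_ext with
      (fun n => u_n a r m n p + (V a r m n (m (S n)) p - u_n a r m n p)); [intros; ring|].
    replace (u p) with (u p + 0) by ring.
    apply is_lim_seq_plus'; [now apply Hu|].
    apply is_lim_seq_abs_0.
    apply is_lim_seq_le_le with (fun _ => 0) (fun n => / 2 ^ n * 1800).
    - intros n; split; [apply Rabs_pos|]; apply V_u_n; [|apply Hm].
      apply (delta_bounds r m hr_pos hr_le Hm).
    - apply is_lim_seq_const.
    - replace 0 with (0 * 1800) by ring; apply is_lim_seq_mult'; [|apply is_lim_seq_const].
      apply ex_series_lim_0, ex_series_half. }
  assert (Hcz : forall k, Complex.Cmod (cz k) <= 1)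
    by (intros; unfold cz; rewrite Cmod_1; lra).
  assert (Hcw : forall k, Complex.Cmod (cw k) <= 1).
  { intros k; unfold cw; destruct (Nat.odd k); [rewrite Cmod_0|rewrite Cmod_pos_RtoC]; lra. }
  destruct (W_lim a r m psi rho ha_disk hr_pos hr_le Hm Hgood ltac:(lra) Hpsi0 Hpm Hpge
              cz 0%C Hcz ltac:(rewrite Cmod_0; lra)) as (wz & Hwz & Hoz).
  destruct (W_lim a r m psi rho ha_disk hr_pos hr_le Hm Hgood ltac:(lra) Hpsi0 Hpm Hpge
              cw 1%C Hcw ltac:(rewrite Cmod_1; lra)) as (ww & Hww & How).
  exists u; split; [intros p Hp; apply is_lim_seq_Reals; now apply Hu|].
  (* [pdot] of the conjugates with [h] is the real part of [w_z h_z + w_w h_w]. *)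
  exists (fun p => (Cconj (wz p), Cconj (ww p))); split.
  - intros p Hp e He.
    destruct (Omega_open p Hp) as (e1 & He1 & HO).
    (* Continuity of [psi] at 0 makes the remainder [240004 psi(|h|) |h|] of [V_taylor] at most
       [e |h|]. *)
    destruct (Hcont 0 ltac:(lra) (e / 240004) ltac:(lra)) as (e2 & He2 & Hc).
    exists (Rmin (Rmin e1 rho) e2); split; [repeat apply Rmin_glb_lt; lra|].
    intros h Hh.
    pose proof (Rmin_l (Rmin e1 rho) e2); pose proof (Rmin_r (Rmin e1 rho) e2).
    pose proof (Rmin_l e1 rho); pose proof (Rmin_r e1 rho).
    assert (Hh0 : 0 <= pnorm h) by apply sqrt_pos.
    assert (HOp : forall q, pdist q p <= pnorm h -> Omega q) by (intros; apply HO; lra).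
    assert (Hq : Omega (padd p h)).
    { apply HOp; pose proof (pdist_line p h 1 ltac:(lra)) as HL.
      replace (line p h 1) with (padd p h) in HL; [exact HL|].
      destruct p as [[] []], h as [[] []]; unfold line, padd, Cadd, Cscale; simpl.
      repeat f_equal; ring. }
    destruct (Hwz p Hp) as [Z1 Z2]; destruct (Hww p Hp) as [W1 W2].
    eapply Rle_trans; [eapply is_lim_seq_abs_le|].
    2:{ intros n; apply (V_taylor a r m psi rho ha_disk hr_pos hr_le Hm Hgood ltac:(lra) Hpsi0 Hpm Hpge
                   n p h HOp); lra. }
    + apply is_lim_seq_minus'; [apply is_lim_seq_minus'; [now apply HV | now apply HV]|].
      replace (pdot (Cconj (wz p), Cconj (ww p)) h)
        with (fst (wz p) * fst (fst h) - snd (wz p) * snd (fst h)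
              + (fst (ww p) * fst (snd h) - snd (ww p) * snd (snd h)))
        by (unfold pdot, Cconj; simpl; ring).
      apply is_lim_seq_plus'; apply is_lim_seq_minus'; apply is_lim_seq_mult';
        try apply is_lim_seq_const; assumption.
    + apply Rmult_le_compat_r; [exact Hh0|].
      specialize (Hc (pnorm h) ltac:(lra)).
      rewrite Hpsi0, !Rminus_0_r, (Rabs_pos_eq (pnorm h)) in Hc by exact Hh0.
      specialize (Hc ltac:(lra)); pose proof (Rle_abs (psi (pnorm h))); lra.
  - intros p Hp; destruct (Omega_open p Hp) as (e1 & He1 & HO).
    (* Two points within [rho / 4] of [p] differ by less than [rho / 2] in each coordinate, hence by
       less than [rho]; [480008] adds the bounds for the two components of the gradient. *)
    exists (Rmin e1 (rho / 4)), 480008.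
    pose proof (Rmin_l e1 (rho / 4)); pose proof (Rmin_r e1 (rho / 4)).
    split; [apply Rmin_glb_lt; lra|split; [intros; apply HO; lra|]].
    intros x y Hx Hy.
    assert (Ox : Omega x) by (apply HO; lra); assert (Oy : Omega y) by (apply HO; lra).
    assert (Hxy : pdist x y < rho).
    { destruct (Cmod_le_pdist x p) as [X1 X2], (Cmod_le_pdist y p) as [Y1 Y2].
      eapply Rle_lt_trans; [apply pdist_le_Cmod|].
      assert (T : forall z w v : C, Complex.Cmod (z - w) <= Complex.Cmod (z - v) + Complex.Cmod (w - v)).
      { intros z w v; replace (z - w)%C with ((z - v) - (w - v))%C by ring; apply Cmod_minus_le. }
      pose proof (T (fst x) (fst y) (fst p)); pose proof (T (snd x) (snd y) (snd p)); lra. }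
    eapply Rle_trans; [apply pdist_le_Cmod|]; simpl fst; simpl snd.
    rewrite <- !Cminus_conj, !Cmod_conj.
    pose proof (Hoz x y Ox Oy Hxy); pose proof (How x y Ox Oy Hxy); lra.
Qed.
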